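(* There exist a 2-step affine nilsystem $(\mathbb{T}^2,\mathcal{B}_{\mathbb{T}^2},m_{\mathbb{T}^2},T_1,T_2,T_3,T_4)$ and polynomials $p_1,p_2,p_3,p_4\in\mathbb{Z}[n]$ such that: (i) $(T_1^{p_1(n)}\times T_2^{p_2(n)}\times T_3^{p_3(n)}\times T_4^{p_4(n)})_{n\in\mathbb{Z}}$ is ergodic for $(\mathbb{T}^8,\mathcal{B}_{\mathbb{T}^8},m_{\mathbb{T}^8})$; (ii) $(T_i^{p_i(n)}T_j^{-p_j(n)})_{n\in\mathbb{Z}}$ is ergodic for $(\mathbb{T}^2,\mathcal{B}_{\mathbb{T}^2},m_{\mathbb{T}^2})$ for all $1\le i<j\le4$; (iii) $(T_1^{p_1(n)},T_2^{p_2(n)},T_3^{p_3(n)},T_4^{p_4(n)})_{n\in\mathbb{Z}}$ is not jointly ergodic for $(\mathbb{T}^2,\mathcal{B}_{\mathbb{T}^2},m_{\mathbb{T}^2})$.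
   Context: $\mathbb{T}=\mathbb{R}/\mathbb{Z}$; $\mathcal B$ and $m$ denote the Borel $\sigma$-algebra and the Haar (Lebesgue) probability measure. A 2-step affine nilsystem $(\mathbb{T}^2,\mathcal{B}_{\mathbb{T}^2},m_{\mathbb{T}^2},T_1,\ldots,T_4)$ is one in which each $T_i$ is a unipotent affine transformation $y\mapsto A_iy+\alpha_i$ of $\mathbb{T}^2$ ($\alpha_i\in\mathbb{T}^2$, $A_i$ an automorphism of $\mathbb T^2$ with $A_i-I$ nilpotent), the system is a 2-step nilsystem (i.e. $\mathbb{T}^2$ is realized as $G/\Gamma$ with $G$ a 2-step nilpotent Lie group and $\Gamma$ a discrete cocompact subgroup, with each $T_i$ acting as left multiplication by an element of $G$), and the group $\langle T_1,\ldots,T_4\rangle$ is 2-step nilpotent. A family $(S_n)_{n\in\mathbb{Z}}$ of measure-preserving transformations on a probability space $(Y,\mathcal Y,\nu)$ is ergodic if for all $f\in L^\infty(\nu)$ and every F\o lner sequence $(\Phi_N)_N$ in $\mathbb{Z}$, $\frac1{|\Phi_N|}\sum_{n\in\Phi_N}f(S_n\,\cdot)\to\int f\,d\nu$ in $L^2(\nu)$. $(T_1^{p_1(n)},\ldots,T_\ell^{p_\ell(n)})_{n\in\mathbb{Z}}$ is jointly ergodic for $(X,\mathcal X,\mu)$ if for all $f_1,\ldots,f_\ell\in L^\infty(\mu)$, $\frac1N\sum_{n=1}^N f_1(T_1^{p_1(n)}\cdot)\cdots f_\ell(T_\ell^{p_\ell(n)}\cdot)\to\int f_1\,d\mu\cdots\int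 f_\ell\,d\mu$ in $L^2(\mu)$ as $N\to\infty$. *)

(* Defs.v *)
From HB Require Import structures.
From mathcomp Require Import all_boot all_order all_algebra finmap.
From mathcomp Require Import all_classical all_reals all_analysis.
From mathcomp Require Import measurable_realfun complex.
Set Implicit Arguments.
Unset Strict Implicit.
Unset Printing Implicit Defensive.

Import Order.TTheory GRing.Theory Num.Theory.
Import numFieldNormedType.Exports.

Local Open Scope classical_set_scope.
Local Open Scope quotient_scope.
Local Open Scope ring_scope.

Definition zpow (G : groupType) (g : G) (n : int) : G :=
  match n with
  | Posz k => (g ^+ k)%g
  | Negz k => (g ^- k.+1)%g
  end.

Section nilpotent_groups.
Variable G : groupType.

Definition generated (S : set G) : set G :=
  [set x | forall H : groupClosed G, (forall y, S y -> y \in H) -> x \in H].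

(* [lcs H k] is the subgroup usually written H_{k+1}. *)
Fixpoint lcs (H : set G) (k : nat) : set G :=
  if k is k'.+1 then
    generated [set z | exists2 x, lcs H k' x & exists2 y, H y & z = [~ x, y]%g]
  else H.

(* [H] is nilpotent of step exactly [s]: not of any smaller step. *)
Definition nilpotent_step (H : set G) (s : nat) : Prop :=
  lcs H s = [set 1%g] /\ forall k, (k < s)%N -> lcs H k <> [set 1%g].

End nilpotent_groups.

(* The group of all bijections of [X], the product being composition. *)
Record bijection (X : Type) := Bijection {
  bij_fun :> X -> X;
  bij_inv : X -> X;
  bij_funK : cancel bij_fun bij_inv;
  bij_invK : cancel bij_inv bij_fun
}.

Section bijection_group.
Variable X : Type.
Implicit Types f g h : bijection X.

Lemma bijectionP f g : (forall x, f x = g x) -> f = g.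
Proof.
case: f => f f' fK f'K; case: g => g g' gK g'K /= fg.
have {fg} e : f = g by exact/funext.
subst g; have e' : f' = g'.
  by apply/funext => x; apply: (can_inj fK); rewrite f'K g'K.
subst g'; congr Bijection; exact: Prop_irrelevance.
Qed.

Definition bij1 : bijection X := @Bijection X id id (frefl _) (frefl _).

Definition bijV f : bijection X := Bijection (bij_invK f) (bij_funK f).

Definition bijM f g : bijection X :=
  Bijection (can_comp (bij_funK f) (bij_funK g))
            (can_comp (bij_invK g) (bij_invK f)).

HB.instance Definition _ := gen_eqMixin (bijection X).
HB.instance Definition _ := gen_choiceMixin (bijection X).

Fact bijMA : associative bijM. Proof. by move=> f g h; exact: bijectionP. Qed.
Fact bij1M : left_id bij1 bijM. Proof. by move=> f; exact: bijectionP. Qed.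
Fact bijM1 : right_id bij1 bijM. Proof. by move=> f; exact: bijectionP. Qed.
Fact bijVM : left_inverse bij1 bijV bijM.
Proof. by move=> f; apply: bijectionP => x /=; rewrite bij_funK. Qed.
Fact bijMV : right_inverse bij1 bijV bijM.
Proof. by move=> f; apply: bijectionP => x /=; rewrite bij_invK. Qed.

HB.instance Definition _ :=
  isGroup.Build (bijection X) bijMA bij1M bijM1 bijVM bijMV.

End bijection_group.

Definition homeomorphism (X Y : topologicalType) (f : X -> Y) : Prop :=
  continuous f /\
  exists g : Y -> X, [/\ cancel f g, cancel g f & continuous g].

HB.mixin Record isTopologicalGroup G of Group G & Topological G := {
  mulg_continuous : continuous (fun xy : G * G => (xy.1 * xy.2)%g);
  invg_continuous : continuous (fun x : G => (x^-1)%g)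
}.

#[short(type="topologicalGroupType")]
HB.structure Definition TopologicalGroup :=
  {G of isTopologicalGroup G & Group G & Topological G}.

Section smooth_maps.
Variable R : realType.

(* [f] is of class C^k on the open set [U]. *)
Fixpoint Ck (n m k : nat) (U : set 'rV[R]_n) (f : 'rV[R]_n -> 'rV[R]_m) : Prop :=
  if k is k'.+1 then
    (forall x, U x -> differentiable f x) /\
    (forall v, Ck k' U (fun x => 'D_v f x))
  else forall x, U x -> {for x, continuous f}.

Definition smooth (n m : nat) (U : set 'rV[R]_n) (f : 'rV[R]_n -> 'rV[R]_m) :=
  forall k, Ck k U f.

End smooth_maps.

Section lie_groups.
Variables (R : realType) (G : topologicalGroupType) (n : nat).

Record chart := Chart {
  chart_dom : set G;
  chart_map :> G -> 'rV[R]_n;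
  chart_inv : 'rV[R]_n -> G
}.

Definition chart_codom (c : chart) : set 'rV[R]_n := c @` chart_dom c.

Definition is_chart (c : chart) : Prop :=
  [/\ open (chart_dom c), open (chart_codom c),
      {in chart_dom c, cancel c (chart_inv c)},
      {within chart_dom c, continuous c} &
      {within chart_codom c, continuous (chart_inv c)}].

Definition smooth_atlas (A : set chart) : Prop :=
  [/\ forall c, A c -> is_chart c,
      forall x, exists2 c, A c & chart_dom c x &
      forall c d, A c -> A d ->
        smooth (c @` (chart_dom c `&` chart_dom d)) (d \o chart_inv c)].

(* Pairs of charts of [G] are charts of [G * G], with values in R^n x R^n,
   which is identified with R^(n + n). *)
Definition smooth_mul (A : set chart) : Prop :=
  forall b c d, A b -> A c -> A d ->
    smooth [set row_mx (b xy.1) (c xy.2) | xy in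
              [set xy | [/\ chart_dom b xy.1, chart_dom c xy.2 &
                            chart_dom d (xy.1 * xy.2)%g]]]
           (fun u => d (chart_inv b (lsubmx u) * chart_inv c (rsubmx u))%g).

Definition smooth_inv (A : set chart) : Prop :=
  forall c d, A c -> A d ->
    smooth [set c x | x in [set x | chart_dom c x /\ chart_dom d (x^-1)%g]]
           (fun u => d ((chart_inv c u)^-1)%g).

End lie_groups.

Definition is_lie_group (R : realType) (G : topologicalGroupType) : Prop :=
  [/\ hausdorff_space G, @second_countable G &
      exists (n : nat) (A : set (chart R G n)),
        [/\ smooth_atlas A, smooth_mul A & smooth_inv A]].

Section coset_space.
Variables (G : topologicalGroupType) (Gamma : groupClosed G).

Definition discrete_subgroup : Prop :=
  forall x, x \in Gamma ->
    exists2 U : set G, open U & U `&` [set y | y \in Gamma] = [set x].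

Definition coset_rel (x y : G) : bool := (x^-1 * y)%g \in Gamma.

Fact coset_rel_equiv : equiv_class_of coset_rel.
Proof.
split=> [x|x y|y x z]; rewrite /coset_rel.
- by rewrite mulVg gpred1.
- by rewrite -[in RHS]gpredV invgM invgK.
- by move=> xy yz; rewrite -(mulgK y x^-1)%g -mulgA gpredM.
Qed.

Canonical coset_equiv := EquivRelPack coset_rel_equiv.
Canonical coset_encModRel := defaultEncModRel coset_rel.

(* The space G / Gamma of left cosets x Gamma, with the quotient topology. *)
Definition coset_space : Type := quotient_topology {eq_quot coset_rel}.
HB.instance Definition _ := Quotient.on coset_space.
HB.instance Definition _ := Topological.on coset_space.

Definition coset_translate (g : G) (q : coset_space) : coset_space :=
  \pi_coset_space (g * repr q)%g.

End coset_space.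

Section torus.
Variable R : realType.

Definition integers : zmodClosed R :=
  GRing.ZmodClosed.clone R (@Num.int_num_subdef R) _.

Definition torus : Type := quotient_topology (Quotient.quot integers).
HB.instance Definition _ := Quotient.on torus.
HB.instance Definition _ := PointedTopological.on torus.
HB.instance Definition _ := GRing.isZmodule.Build torus
  (@Quotient.addqA R integers) (@Quotient.addqC R integers)
  (@Quotient.add0q R integers) (@Quotient.addNq R integers).
HB.instance Definition _ := Measurable.copy torus
  (g_sigma_algebraType [set A : set torus | open A]).

Definition torus_pi (x : measurableTypeR R) : torus := \pi_torus x.

Lemma torus_piD (x y : R) : torus_pi (x + y) = torus_pi x + torus_pi y.
Proof. exact: Quotient.pi_add. Qed.

Lemma torus_pi_eq (x y : R) :
  torus_pi x = torus_pi y <-> x - y \is a Num.int.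
Proof.
have -> : (x - y \is a Num.int) = (x - y \in integers) by [].
by rewrite (Quotient.idealrBE integers); split=> [e|/eqP//]; apply/eqP.
Qed.

Lemma measurable_torus_pi : measurable_fun [set: measurableTypeR R] torus_pi.
Proof.
apply: (@measurability _ _ _ _ _ _ [set A : set torus | open A]) => //.
by move=> _ [A oA <-]; rewrite setTI; exact: open_measurable.
Qed.

Definition haar_torus : set torus -> \bar R :=
  pushforward (mrestr lebesgue_measure (measurable_itv `[0%R, 1%R[)) torus_pi.

Let haar_torusT : haar_torus [set: torus] = 1%E.
Proof.
rewrite /haar_torus /pushforward preimage_setT /mrestr setTI.
by rewrite lebesgue_measure_itv/= lte_fin ltr01 oppr0 adde0.
Qed.

Let haar_torus0 : haar_torus set0 = 0%E.
Proof. by apply: measure0; exact: measurable_torus_pi. Qed.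

Let haar_torus_ge0 A : (0 <= haar_torus A)%E.
Proof. by apply: measure_ge0; exact: measurable_torus_pi. Qed.

Let haar_torus_sigma_additive : semi_sigma_additive haar_torus.
Proof.
by apply: measure_semi_sigma_additive; exact: measurable_torus_pi.
Qed.

HB.instance Definition _ := isMeasure.Build _ _ _ haar_torus
  haar_torus0 haar_torus_ge0 haar_torus_sigma_additive.
HB.instance Definition _ :=
  Measure_isProbability.Build _ _ _ haar_torus haar_torusT.

End torus.

Arguments haar_torus : clear implicits.

(* The product sigma-algebra carried by this product is the Borel one, the torus
   being second countable. *)
Notation torus2 R := (torus R * torus R)%type.

Definition haar2 (R : realType) : probability (torus2 R) R :=
  (haar_torus R \x haar_torus R)%E.

Section ergodicity.
Context (R : realType) (d : measure_display) (X : measurableType d).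
Variable mu : probability X R.
Implicit Types f : X -> R[i].

(* Complex-valued functions, [R[i]] being the field of complex numbers. *)
Definition Linfty f : Prop :=
  (fun x => complex.Re (f x)) \in Lfun mu +oo%E /\
  (fun x => complex.Im (f x)) \in Lfun mu +oo%E.

Definition cintegral f : R[i] :=
  ((\int[mu]_x complex.Re (f x)) +i* (\int[mu]_x complex.Im (f x)))%C.

Definition cvg_L2 (F : nat -> X -> R[i]) f : Prop :=
  (fun N => 'N[mu]_(2%:E)
     [(fun x => (ComplexField.Normc.normc (F N x - f x)%R)%:E)]%E)
    @ \oo --> 0%E.

Definition measure_preserving (S : X -> X) : Prop :=
  measurable_fun setT S /\
  forall A, measurable A -> mu (S @^-1` A) = mu A.

Definition translate_fset (h : int) (A : {fset int}) : {fset int} :=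
  [fset (h + n)%R | n in A]%fset.

Definition symdiff_fset (A B : {fset int}) : {fset int} :=
  ((A `\` B) `|` (B `\` A))%fset.

Definition folner (Phi : nat -> {fset int}) : Prop :=
  (forall N, Phi N != fset0) /\
  forall h : int,
    (fun N => #|` symdiff_fset (translate_fset h (Phi N)) (Phi N) |%:R
              / #|` Phi N |%:R : R) @ \oo --> (0 : R).

Definition ergodic (S : int -> X -> X) : Prop :=
  (forall n, measure_preserving (S n)) /\
  forall f, Linfty f -> forall Phi, folner Phi ->
    cvg_L2 (fun N x => #|` Phi N |%:R^-1 * \sum_(n <- Phi N) f (S n x))
           (fun=> cintegral f).

Definition jointly_ergodic (l : nat) (T : 'I_l -> bijection X)
    (p : 'I_l -> {poly int}) : Prop :=
  forall f : 'I_l -> X -> R[i], (forall i, Linfty (f i)) ->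
    cvg_L2 (fun N x => N%:R^-1 * \sum_(1 <= n < N.+1)
                          \prod_(i < l) f i (zpow (T i) (p i).[n%:Z] x))
           (fun=> \prod_(i < l) cintegral (f i)).

End ergodicity.

Definition prod4 (X : Type) (S : 'I_4 -> X -> X) (x : X * X * X * X) :=
  (S 0 x.1.1.1, S 1 x.1.1.2, S 2 x.1.2, S 3 x.2).

Section nilsystems.
Variables (R : realType) (l : nat).
Implicit Types T : 'I_l -> bijection (torus2 R).

Definition unipotent_affine (S : torus2 R -> torus2 R) : Prop :=
  exists (A : {additive torus2 R -> torus2 R}) (alpha : torus2 R),
    [/\ homeomorphism A,
        exists k, forall y, iter k (fun z => A z - z) y = 0 &
        forall y, S y = A y + alpha].

(* [G] is not required to be connected. The map [phi] identifies T^2 with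
   G / Gamma, and the Haar measure of T^2 with the G-invariant measure. *)
Definition nilsystem (s : nat) T : Prop :=
  exists (G : topologicalGroupType) (Gamma : groupClosed G)
         (phi : coset_space Gamma -> torus2 R),
  [/\ is_lie_group R G,
      nilpotent_step [set: G] s,
      discrete_subgroup Gamma &
      compact [set: coset_space Gamma]] /\
  [/\ homeomorphism phi,
      forall (g : G) (A : set (torus2 R)), measurable A ->
        haar2 R [set phi (coset_translate g q) | q in phi @^-1` A] = haar2 R A &
      forall i, exists g : G, forall q, T i (phi q) = phi (coset_translate g q)].

Definition affine_nilsystem (s : nat) T : Prop :=
  [/\ forall i, unipotent_affine (T i),
      nilsystem s T &
      nilpotent_step (generated (range T)) s].

End nilsystems.

(* Main.v *)
(** Take the skew products [T_i (x, y) = (x + a_i, y + 2 x + a_i + c_i)], whose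
    iterates are [T_i^n (x, y) = (x + n a_i, y + 2 n x + n^2 a_i + n c_i)], with
    [a = (2 sqrt 3, sqrt 2, sqrt 2, sqrt 2)], [c = (0, sqrt 3, 0, 2 sqrt 3)] and
    [p = (n, n^3, n^3 + n^2 - n, n^3 - n^2)].

    The relations [p_1 - 2 p_2 + p_3 + p_4 = 0] and
    [- 2 p_2^2 + p_3^2 + p_4^2 = - 2 p_2 + n^2] make the product of the
    characters [e(y)], [e(x - 2 y)], [e(y)], [e(x + y)] along the four orbits
    independent of [n], although [e(y)] has integral zero: joint ergodicity fails.

    For the product system and for the pairs it is enough to average characters.
    One that involves some coordinate [y_i] has orthogonal translates, up to
    finitely many coincidences for each [n], because the coefficient of [x_i]
    is a nonconstant polynomial in [n]. One that involves only the [x_i] has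
    phase [\sum_i m_i a_i p_i(n)], whose leading coefficient is irrational because
    [1], [sqrt 2], [sqrt 3] are linearly independent over the rationals, so that
    its averages vanish by Weyl differencing along the Folner sequence. Characters
    suffice because their closure under linear combinations and bounded pointwise
    limits is an algebra that contains the indicators of all Borel sets.

    The maps act by translation on [G / Gamma], where [G = Z x R x R] is the group
    of the maps [(x, y) |-> (x + a, y + k x + b)] and [Gamma = Z^3]. *)

From HB Require Import structures.
Require Import Defs.
From mathcomp Require Import all_boot all_order all_algebra finmap.
From mathcomp Require Import all_classical all_reals all_analysis.
From mathcomp Require Import measurable_realfun complex ring lra zify.
Set Implicit Arguments.
Unset Strict Implicit.
Unset Printing Implicit Defensive.
Import Order.TTheory GRing.Theory Num.Theory.
Import numFieldNormedType.Exports.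
Local Open Scope classical_set_scope.
Local Open Scope quotient_scope.
Local Open Scope ring_scope.

(** * The circle *)

(** The relation p_1 - 2 p_2 + p_3 + p_4 = 0 removes x from the phase, but with equal rotations it
    would also be a resonance between the first coordinates, and the product system would not be
    ergodic. Hence a_1 is rationally independent of the common value sqrt 2 of the other rotations,
    while p_2, p_3, p_4 are linearly independent. The price is a term p_1^2 a_1 = 2 sqrt 3 n^2,
    which no characters in the x_i can cancel, because there sqrt 3 occurs only with p_1 = n. The
    drifts c_i cancel it: they act on y alone, so they do not enter the phases of the characters in
    the x_i. The distinct a_1 also keeps the group generated by the maps from being abelian.

    Convergence is first proved in L^1 for functions bounded everywhere, where averaging is a
    contraction uniformly in the Folner set; the uniform bounds give L^2 at the end. Folner sets
    need not be intervals, so exponential sums are controlled by approximate shift invariance and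
    not by summing geometric series. *)

Section torus_theory.
Variable R : realType.
Local Notation T := (torus R).
Local Notation pi := (@torus_pi R).

Lemma torus_pi0 : pi 0 = 0.
Proof. by rewrite -[LHS](addrK (pi 0)) -torus_piD addr0 subrr. Qed.

Lemma torus_piN (x : R) : pi (- x) = - pi x.
Proof.
by apply/eqP; rewrite -subr_eq0 opprK -torus_piD addNr torus_pi0.
Qed.

Lemma torus_piB (x y : R) : pi (x - y) = pi x - pi y.
Proof. by rewrite torus_piD torus_piN. Qed.

Lemma torus_piMz (x : R) (m : int) : pi (m%:~R * x) = pi x *~ m.
Proof.
have H (n : nat) : pi (n%:R * x) = pi x *+ n.
  elim: n => [|n IH]; first by rewrite mul0r torus_pi0.
  by rewrite -natr1 mulrDl mul1r torus_piD IH mulrSr.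
case: m => n; first by rewrite -pmulrn H.
by rewrite NegzE mulrNz mulNr torus_piN -pmulrn H.
Qed.

Lemma torus_pi_int (m : int) : pi m%:~R = 0.
Proof. by rewrite -torus_pi0; apply/torus_pi_eq; rewrite subr0. Qed.

Lemma torus_pi_eq0 (x : R) : pi x = 0 <-> x \is a Num.int.
Proof. by rewrite -{1}torus_pi0 torus_pi_eq subr0. Qed.

Lemma torus_pi_surj (z : T) : exists x : R, z = pi x.
Proof. by exists (repr z); rewrite /torus_pi reprK. Qed.

(** The representative chosen by [repr] is arbitrary; reduced to [0, 1) it becomes a Borel function,
    through which measurability on the circle is transferred to the real line. *)
Definition torus_section (z : T) : R := repr z - (Num.floor (repr z))%:~R.

Lemma torus_sectionK : cancel torus_section pi.
Proof.
move=> z; rewrite /torus_section torus_piB torus_pi_int subr0.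
exact: reprK.
Qed.

Lemma torus_section_itv z : 0 <= torus_section z < 1.
Proof.
have := Num.Theory.floor_itv (repr z); rewrite /torus_section => /andP[h1 h2].
by rewrite subr_ge0 h1 /= ltrBlDr addrC -intrD1.
Qed.

Lemma torus_pi_inj (x y : R) :
  0 <= x < 1 -> 0 <= y < 1 -> pi x = pi y -> x = y.
Proof.
move=> /andP[x0 x1] /andP[y0 y1] /torus_pi_eq /intrP[m xyE].
suff m0 : m = 0 by apply/eqP; rewrite -subr_eq0 xyE m0.
have h1 : (-1 < m%:~R :> R) by rewrite -xyE; lra.
have h2 : (m%:~R < 1 :> R) by rewrite -xyE; lra.
move: h1 h2; rewrite -[1]/(1%:~R) -mulrNz !ltr_int.
by case: m {xyE} => [[|n]|n].
Qed.

Lemma torus_piK (x : R) : 0 <= x < 1 -> torus_section (pi x) = x.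
Proof.
by move=> x01; apply: torus_pi_inj => //; [exact: torus_section_itv|rewrite torus_sectionK].
Qed.

Lemma torus_pi_continuous : continuous (\pi_(torus R) : R -> T).
Proof. exact: pi_continuous. Qed.

(** The saturation of an open set is the union of its integer translates. *)
Lemma torus_pi_open (U : set R) : open U -> open ((\pi_(torus R) : R -> T) @` U).
Proof.
move=> oU.
suff -> : open ((\pi_(torus R) : R -> T) @` U) =
  open (\bigcup_(m : int) ((fun x : R => x + m%:~R) @^-1` U)).
  apply: bigcup_open => m _; apply: open_comp => // x _.
  by apply: cvgD; [exact: cvg_id|exact: cvg_cst].
rewrite [LHS]/open /= /quotient_open; congr open.
apply/seteqP; split => [x [y Uy] /torus_pi_eq /intrP[m yx]|x [m _ Um]].
  by exists m => //=; rewrite -yx addrC subrK.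
exists (x + m%:~R) => //; apply/torus_pi_eq.
by rewrite addrC addKr.
Qed.

(** A product of quotient maps need not be a quotient map, so continuity on [T * T] is not automatic
    from continuity on [R * R]; openness of the projection carries a box of neighbourhoods down. *)
Lemma torus_add_continuous : continuous (fun z : T * T => z.1 + z.2).
Proof.
move=> [a b] /= A; rewrite nbhsE => -[B [oB Bab] BA].
have [x ax] := torus_pi_surj a; have [y bY] := torus_pi_surj b.
have c : (fun z : R * R => \pi_(torus R) (z.1 + z.2) : T) z @[z --> (x, y)]
    --> (\pi_(torus R) (x + y) : T).
  apply: (@cvg_comp _ _ _ (fun z : R * R => z.1 + z.2) (\pi_(torus R)));
    last exact: torus_pi_continuous.
  by apply: cvgD; [exact: cvg_fst|exact: cvg_snd].
have nB : nbhs (\pi_(torus R) (x + y) : T) B.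
  by apply: open_nbhs_nbhs; split => //; move: Bab; rewrite ax bY -torus_piD.
have [[U V] /= [nU nV] UV] := c _ nB.
move: nU nV; rewrite nbhsE => -[U' [oU' U'x] U'U].
rewrite nbhsE => -[V' [oV' V'x] V'V].
exists ((\pi_(torus R) : R -> T) @` U', (\pi_(torus R) : R -> T) @` V').
  by split => /=; apply: open_nbhs_nbhs; (split; first exact: torus_pi_open);
    [rewrite ax; exists x|rewrite bY; exists y].
move=> [_ _] /= [[u Uu <-] [v Vv <-]]; apply: BA.
by have := UV (u, v) (conj (U'U _ Uu) (V'V _ Vv)); rewrite /= -/(pi _) torus_piD.
Qed.

Lemma torus_open_measurable (A : set T) : open A -> measurable A.
Proof. by move=> oA; apply: sub_sigma_algebra. Qed.

(** Open rays generate the Borel sets, and for [a >= 0] the preimage of a ray is the image of an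
    open interval, hence an open arc. *)
Lemma measurable_torus_section :
  measurable_fun [set: T] (torus_section : T -> measurableTypeR R).
Proof.
apply: (measurability _ (RGenOInfty.measurableE R)) => _ [_ [a ->] <-].
rewrite setTI; apply: torus_open_measurable.
have -> : torus_section @^-1` `]a, +oo[%classic =
    (if a < 0 then setT else (\pi_(torus R) : R -> T) @` `]a, 1[%classic).
  apply/seteqP; split => z /=; have /andP[z0 z1] := torus_section_itv z.
    rewrite in_itv /= andbT => az; case: ifP => // _.
    by exists (torus_section z); rewrite /= ?in_itv /= ?az ?z1 //; exact: torus_sectionK.
  case: ifPn => [a0 _|]; first by rewrite in_itv /= andbT (lt_le_trans a0).
  rewrite -leNgt => a0 [x /=]; rewrite in_itv /= => /andP[ax x1] <-.
  rewrite in_itv /= andbT torus_piK ?ax // x1 andbT.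
  exact: ltW (le_lt_trans a0 ax).
by case: ifP => _; [exact: openT|apply: torus_pi_open; exact: interval_open].
Qed.

Lemma measurable_torus_pi_comp d (X : measurableType d) (f : X -> measurableTypeR R) :
  measurable_fun [set: X] f -> measurable_fun [set: X] (fun x => pi (f x)).
Proof. by move=> mf; apply: measurableT_comp => //; exact: measurable_torus_pi. Qed.

Lemma measurable_torus_add d (X : measurableType d) (f g : X -> T) :
  measurable_fun setT f -> measurable_fun setT g ->
  measurable_fun setT (fun x => f x + g x).
Proof.
move=> mf mg.
have -> : (fun x => f x + g x) =
    (fun x => pi (torus_section (f x) + torus_section (g x))).
  by apply/funext => x; rewrite torus_piD !torus_sectionK.
apply: measurable_torus_pi_comp; apply: measurable_funD;
  by apply: (measurableT_comp measurable_torus_section).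
Qed.

Lemma measurable_torus_mulz d (X : measurableType d) (f : X -> T) (m : int) :
  measurable_fun setT f -> measurable_fun setT (fun x => f x *~ m).
Proof.
move=> mf.
have -> : (fun x => f x *~ m) = (fun x => pi (m%:~R * torus_section (f x))).
  by apply/funext => x; rewrite torus_piMz !torus_sectionK.
apply: measurable_torus_pi_comp; apply: measurable_funM => //.
by apply: (measurableT_comp measurable_torus_section).
Qed.

Lemma measurable_torus_opp d (X : measurableType d) (f : X -> T) :
  measurable_fun setT f -> measurable_fun setT (fun x => - f x).
Proof.
move=> mf; rewrite (_ : (fun x => - f x) = (fun x => f x *~ -1)).
  exact: measurable_torus_mulz.
by apply/funext => x; rewrite mulrN1z.
Qed.

Lemma lebesgue_measure_shift (c : R) (A : set (measurableTypeR R)) : measurable A ->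
  lebesgue_measure ((fun x : R => x + c) @^-1` A) = lebesgue_measure A.
Proof.
move=> mA.
have mc : measurable_fun [set: measurableTypeR R]
    ((fun x : R => x + c) : _ -> measurableTypeR R).
  by apply: measurable_funD.
apply/esym.
apply: (@lebesgue_measure_unique R
  (measure_function_pushforward__canonical__measure_function_Measure
    lebesgue_measure mc)) => // _ [[a b] _ <-].
transitivity (lebesgue_measure (`]a - c, b - c]%classic : set R)); last first.
  rewrite /= /pushforward; congr lebesgue_measure.
  by apply/seteqP; split => x /=; rewrite !in_itv /= ltrBlDr lerBrDr.
rewrite /= !lebesgue_measure_itv /= !lte_fin ltrD2r; case: ifP => // _.
by rewrite -!EFinD; congr EFin; ring.
Qed.

Lemma haar_torusE (A : set T) :
  haar_torus R A = lebesgue_measure (pi @^-1` A `&` `[0, 1[).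
Proof. by []. Qed.

(** Cut [0, 1) at [1 - r]: the left piece is moved by [r] onto [r, 1), the right piece by [r - 1]
    onto [0, r), and an integer more or less is invisible on the circle. *)
Lemma haar_torus_shift (t : T) (A : set T) : measurable A ->
  haar_torus R ((fun z => z + t) @^-1` A) = haar_torus R A.
Proof.
move=> mA; rewrite -(torus_sectionK t); move: (torus_section_itv t).
move: (torus_section t) => r /andP[r0 r1].
have mB : measurable (pi @^-1` A : set (measurableTypeR R)).
  by rewrite -[X in measurable X]setTI; exact: measurable_torus_pi.
rewrite !haar_torusE.
have E (B : set R) (a : R) : 0 <= a <= 1 -> B `&` `[0, 1[ = (B `&` `[0, a[) `|` (B `&` `[a, 1[).
  move=> /andP[a0 a1]; rewrite -setIUr; congr (_ `&` _); apply/seteqP; split => x /=;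
    rewrite !in_itv /=.
    by case: (ltP x a) => xa /andP[-> ->]; [left|right].
  by move=> [|] /andP[h1 h2]; apply/andP; split => //; lra.
have mI (B : set (measurableTypeR R)) (i : interval R) :
  measurable B -> measurable (B `&` [set` i] : set (measurableTypeR R)).
  by move=> ?; apply: measurableI => //; exact: measurable_itv.
have disj (B : set R) (a : R) : (B `&` `[0, a[) `&` (B `&` `[a, 1[) = set0.
  apply/seteqP; split => x //= [[_ +] [_ +]]; rewrite !in_itv /=.
  by move=> /andP[_ +] /andP[+ _] => h1 h2; move: (lt_le_trans h1 h2); rewrite ltxx.
have shiftE (c a b : R) (B : set (measurableTypeR R)) : measurable B ->
    lebesgue_measure ((fun x : R => x + c) @^-1` B `&` `[a, b[) =
    lebesgue_measure (B `&` `[a + c, b + c[).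
  move=> mB'; rewrite -[RHS](@lebesgue_measure_shift c); last exact: mI.
  congr lebesgue_measure; rewrite preimage_setI; congr (_ `&` _).
  by apply/seteqP; split => x /=; rewrite !in_itv /= lerD2r ltrD2r.
have -> : pi @^-1` ((fun z => z + pi r) @^-1` A) =
    (fun x : R => x + r) @^-1` (pi @^-1` A).
  by apply/seteqP; split => x /=; rewrite torus_piD.
have mBr c : measurable ((fun x : R => x + c) @^-1` (pi @^-1` A) : set (measurableTypeR R)).
  rewrite -[X in measurable X]setTI; apply: (measurable_funD _ _ _ mB) => //.
rewrite (E _ (1 - r)); last by lra.
rewrite (E (pi @^-1` A) r); last by lra.
rewrite measureU; try exact: mI; last exact: disj.
rewrite measureU; try exact: mI; last exact: disj.
have -> : (fun x : R => x + r) @^-1` (pi @^-1` A) `&` `[(1 - r), 1[ =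
  (fun x : R => x + (r - 1)) @^-1` (pi @^-1` A) `&` `[(1 - r), 1[.
  congr (_ `&` _); apply/seteqP; split => x /=; rewrite !torus_piD torus_piN;
    by rewrite -[1]/(1%:~R) torus_pi_int subr0.
have e1 := shiftE r 0 (1 - r) _ mB; have e2 := shiftE (r - 1) (1 - r) 1 _ mB.
apply: (etrans (congr2 (fun a b => a + b)%E e1 e2)).
have -> : 1 - r + (r - 1) = 0 :> R by ring.
have -> : 1 + (r - 1) = r :> R by ring.
by rewrite add0r subrK addeC.
Qed.
End torus_theory.

(** * Measure-preserving maps *)

Section measure_preserving_theory.
Context (R : realType).

Lemma measure_preserving_integral d (X : measurableType d) (mu : probability X R)
    (S : X -> X) (f : X -> \bar R) : measure_preserving mu S ->
  measurable_fun setT f -> (forall x, 0 <= f x)%E ->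
  (\int[mu]_x f (S x) = \int[mu]_x f x)%E.
Proof.
move=> [mS muS] mf f0.
have := @ge0_integral_pushforward _ _ X X R S mS mu setT f measurableT mf (fun y _ => f0 y).
rewrite preimage_setT /= => <-.
by apply: eq_measure_integral => A mA _; exact: muS.
Qed.

(** Integrate over the fibre first: invariance in the fibre replaces the section at [x] by the
    section at [s x], and invariance of the base removes [s]. *)
Lemma measure_preserving_skew d1 d2 (X : measurableType d1) (Y : measurableType d2)
    (P : probability X R) (Q : probability Y R) (s : X -> X) (r : X -> Y -> Y) :
  measure_preserving P s -> (forall x, measure_preserving Q (r x)) ->
  measurable_fun setT (fun z : X * Y => r z.1 z.2) ->
  measure_preserving (P \x Q)%E (fun z => (s z.1, r z.1 z.2)).
Proof.
move=> mps mpr mr.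
have mS : measurable_fun setT (fun z : X * Y => (s z.1, r z.1 z.2)).
  apply: measurable_fun_pair => //.
  by apply: measurableT_comp measurable_fst; exact: mps.1.
split=> // A mA.
rewrite /= /product_measure1.
transitivity (\int[P]_x (Q (xsection A (s x))))%E.
  apply: eq_integral => x _ /=; rewrite -[RHS](mpr x).2; last exact: measurable_xsection.
  by congr (Q _).
have := @measure_preserving_integral _ X P s (Q \o xsection A) mps.
by apply => //; exact: measurable_fun_xsection.
Qed.

Lemma measure_preserving_prod d1 d2 (X : measurableType d1) (Y : measurableType d2)
    (P : probability X R) (Q : probability Y R) (s : X -> X) (r : Y -> Y) :
  measure_preserving P s -> measure_preserving Q r ->
  measure_preserving (P \x Q)%E (fun z => (s z.1, r z.2)).
Proof.
move=> mps mpr; apply: (@measure_preserving_skew _ _ _ _ P Q s (fun=> r)) => //.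
exact: (measurableT_comp mpr.1 measurable_snd).
Qed.

Lemma measure_preserving_id d (X : measurableType d) (P : probability X R) :
  measure_preserving P id.
Proof. by split; [exact: measurable_id|]. Qed.

Lemma measure_preserving_prod4 d (X : measurableType d) (P : probability X R)
    (S : 'I_4 -> X -> X) : (forall i, measure_preserving P (S i)) ->
  measure_preserving (P \x P \x P \x P)%E (prod4 S).
Proof.
move=> mp.
exact: (measure_preserving_prod (measure_preserving_prod
  (measure_preserving_prod (mp 0) (mp 1)) (mp 2)) (mp 3)).
Qed.

Lemma measure_preserving_torus_shift (t : torus R) :
  measure_preserving (haar_torus R) (fun z => z + t).
Proof.
split; last by move=> A; exact: haar_torus_shift.
exact: measurable_torus_add.
Qed.

Definition skew (a : torus R) (k : int) (b : torus R) (z : torus2 R) : torus2 R :=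
  (z.1 + a, z.2 + z.1 *~ k + b).

Lemma measure_preserving_skew_torus a k b :
  measure_preserving (haar2 R) (skew a k b).
Proof.
apply: (@measure_preserving_skew _ _ _ _ (haar_torus R) (haar_torus R)
  (fun x => x + a) (fun x y => y + x *~ k + b)).
- exact: measure_preserving_torus_shift.
- move=> x; rewrite (_ : (fun y => _) = (fun y => y + (x *~ k + b))).
    exact: measure_preserving_torus_shift.
  by apply/funext => y; rewrite addrA.
- do 2 apply: measurable_torus_add => //.
  exact: measurable_torus_mulz.
Qed.

End measure_preserving_theory.

(** * Monotone classes *)

Section monotone_class.
Context (R : realType) (X : Type).
Implicit Types (f g : X -> R) (B W : set (X -> R)).

Record monotone_class W : Prop := MonotoneClass {
  mc_cst1 : W (fun=> 1);
  mc_lin : forall a f g, W f -> W g -> W (fun x => a * f x + g x);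
  mc_lim : forall (h : nat -> X -> R) f M, (forall n, W (h n)) ->
    (forall n x, `|h n x| <= M) -> (forall x, h n x @[n --> \oo] --> f x) -> W f
}.

(** Being the intersection of all classes that contain [B], it comes with an induction principle: a
    property passes from [B] to its closure as soon as the functions that have it form a monotone
    class. *)
Definition mclosure B : set (X -> R) :=
  [set f | forall W, monotone_class W -> B `<=` W -> W f].

Lemma mclosure_class B : monotone_class (mclosure B).
Proof.
split=> [W mW BW|a f g Bf Bg W mW BW|h f M hB hM hf W mW BW].
- exact: mc_cst1.
- by apply: mc_lin => //; [exact: Bf|exact: Bg].
- by apply: (mc_lim mW _ hM hf) => n; exact: hB.
Qed.

Lemma mclosure_sub B : B `<=` mclosure B.
Proof. by move=> f Bf W _; exact. Qed.

Lemma limr_norm_le (u : nat -> R) l M :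
  (forall n, `|u n| <= M) -> u n @[n --> \oo] --> l -> `|l| <= M.
Proof.
by move=> uM ul; apply: (cvgr_to_le (cvg_norm ul)); near=> n.
Unshelve. all: by end_near. Qed.

Lemma bounded_class : monotone_class [set f | exists M : R, forall x, `|f x| <= M].
Proof.
split=> [|a f g [M fM] [N gN]|h f M hB hM hf].
- by exists 1 => x; rewrite normr1.
- exists (`|a| * M + N) => x; rewrite (le_trans (ler_normD _ _))// lerD//.
  by rewrite normrM ler_wpM2l.
- by exists M => x; exact: (@limr_norm_le (h ^~ x)).
Qed.

Section multiplicative.
Variable B : set (X -> R).
Hypothesis Bbounded : forall f, B f -> exists M : R, forall x, `|f x| <= M.
Hypothesis Bmul : forall f g, B f -> B g -> mclosure B (fun x => f x * g x).

Let W := mclosure B.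
Let mW : monotone_class W := mclosure_class B.

Lemma mclosure_bounded f : W f -> exists M : R, forall x, `|f x| <= M.
Proof. by move=> Wf; exact: (Wf _ bounded_class). Qed.

Let mul_class f : W f -> (exists M : R, forall x, `|f x| <= M) ->
  monotone_class [set g | W (fun x => f x * g x)].
Proof.
move=> Wf [M fM]; split=> /=.
- by rewrite (_ : (fun x => _) = f)//; apply/funext => x; rewrite mulr1.
- move=> a g h /(mc_lin mW a)/[apply].
  by congr (W _); apply/funext => x; ring.
- move=> h g N Wh hN hg; apply: (mc_lim mW Wh (M := M * N)) => [n x|x].
    by rewrite normrM ler_pM.
  by apply: cvgM => //; exact: cvg_cst.
Qed.

(** As in the pi-lambda theorem, one factor at a time: the multipliers that keep a fixed member of
    [B] in the closure form a monotone class, and then the same is said of a fixed member of the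
    closure. *)
Lemma mclosure_mul f g : W f -> W g -> W (fun x => f x * g x).
Proof.
have BW f' g' : B f' -> W g' -> W (fun x => f' x * g' x).
  move=> Bf Wg; apply: (Wg _ (mul_class (mclosure_sub Bf) (Bbounded Bf))).
  by move=> h Bh; exact: Bmul.
move=> Wf Wg; apply: (Wg _ (mul_class Wf (mclosure_bounded Wf))) => h Bh /=.
by rewrite (_ : (fun x => _) = (fun x => h x * f x)); [exact: BW|apply/funext => x; rewrite mulrC].
Qed.

Lemma mclosure_cst a : W (fun=> a).
Proof.
have := mc_lin mW (a - 1) (mc_cst1 mW) (mc_cst1 mW).
by congr (W _); apply/funext => x; ring.
Qed.

Lemma mclosure_scale a f : W f -> W (fun x => a * f x).
Proof.
move=> Wf; have := mc_lin mW a Wf (mclosure_cst 0).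
by congr (W _); apply/funext => x; ring.
Qed.

Lemma mclosure_add f g : W f -> W g -> W (fun x => f x + g x).
Proof.
move=> Wf Wg; have := mc_lin mW 1 Wf Wg.
by congr (W _); apply/funext => x; ring.
Qed.

Lemma mclosure_sum (I : Type) (s : seq I) (F : I -> X -> R) :
  (forall i, W (F i)) -> W (fun x => \sum_(i <- s) F i x).
Proof.
move=> WF; elim: s => [|i s IH].
  rewrite (_ : (fun x => _) = (fun=> 0)); first exact: mclosure_cst.
  by apply/funext => x; rewrite big_nil.
rewrite (_ : (fun x => _) = (fun x => F i x + \sum_(j <- s) F j x)).
  exact: mclosure_add.
by apply/funext => x; rewrite big_cons.
Qed.

Lemma mclosure_prod n (F : nat -> X -> R) :
  (forall i, W (F i)) -> W (fun x => \prod_(i < n) F i x).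
Proof.
move=> WF; elim: n => [|n IH].
  rewrite (_ : (fun x => _) = (fun=> 1)); first exact: mclosure_cst.
  by apply/funext => x; rewrite big_ord0.
rewrite (_ : (fun x => _) = (fun x => (\prod_(i < n) F i x) * F n x)).
  exact: mclosure_mul.
by apply/funext => x; rewrite big_ord_recr.
Qed.

Definition mclosure_sets : set (set X) := [set A | W \1_A].

Lemma mclosure_setC A : mclosure_sets A -> mclosure_sets (~` A).
Proof.
move=> WA; have := mclosure_add (mclosure_cst 1) (mclosure_scale (-1) WA).
congr (W _); apply/funext => x; rewrite !indicE in_setC.
by case: (x \in A) => /=; ring.
Qed.

(** The indicator of the complement is the bounded limit of the finite products of the indicators of
    the complements. *)
Lemma mclosure_bigcup (A : (set X)^nat) :
  (forall n, mclosure_sets (A n)) -> mclosure_sets (\bigcup_k A k).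
Proof.
move=> WA; rewrite -(setCK (\bigcup_k A k)); apply: mclosure_setC.
apply: (mc_lim mW (h := fun n x => \prod_(i < n) \1_(~` A i) x) (M := 1)).
- move=> n; apply: (mclosure_prod n (F := fun i => \1_(~` A i))) => i.
  exact: mclosure_setC.
- move=> n x; rewrite normr_prod; apply: prodr_ile1 => i _.
  by rewrite normr_ge0 indicE; case: (_ \in _); rewrite ?normr1 ?normr0 ?lexx ?ler01.
move=> x; apply: cvg_near_cst; rewrite indicE.
have [[k _ Ak]|nA] := pselect ((\bigcup_k A k) x).
  exists k.+1 => //= n /= kn.
  rewrite (bigD1 (Ordinal kn)) //= indicE in_setC (mem_set Ak) mul0r.
  by rewrite in_setC mem_set //; exists k.
exists 0 => //= n _; rewrite in_setC memNset //= big1 // => i _.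
by rewrite indicE in_setC memNset // => Ai; apply: nA; exists i.
Qed.

Lemma mclosure_sigma_algebra : sigma_algebra setT mclosure_sets.
Proof.
split.
- by have := mclosure_cst 0; rewrite /mclosure_sets /= indic0.
- by move=> A; rewrite setTD; exact: mclosure_setC.
- exact: mclosure_bigcup.
Qed.

Lemma mclosure_setI A A' :
  mclosure_sets A -> mclosure_sets A' -> mclosure_sets (A `&` A').
Proof. by move=> WA WA'; rewrite /mclosure_sets /= indicI; exact: mclosure_mul. Qed.

Lemma mclosure_setU A A' :
  mclosure_sets A -> mclosure_sets A' -> mclosure_sets (A `|` A').
Proof.
move=> WA WA'; rewrite -[_ `|` _]setCK setCU.
by apply: mclosure_setC; apply: mclosure_setI; exact: mclosure_setC.
Qed.

(* The iterates of this polynomial converge to the sign function on [-1, 1]. *)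
Definition smoothstep (v : R) : R := (3 * v - v ^+ 3) / 2.

Lemma smoothstepN v : smoothstep (- v) = - smoothstep v.
Proof. by rewrite /smoothstep; field. Qed.

Lemma iter_smoothstep_itv n v : 0 < v <= 1 -> v <= iter n smoothstep v <= 1.
Proof.
move=> /andP[v0 v1]; elim: n => [|n /=]; first by rewrite /= lexx.
move: (iter n _ v) => w /andP[vw w1].
have w0 : 0 < w by exact: lt_le_trans vw.
(* The first form shows that a step does not decrease a value in (0, 1], the second, with its double
   root at 1, that it does not pass 1. *)
have e1 : smoothstep w = w + w * (1 - w ^+ 2) / 2 by rewrite /smoothstep; field.
have e2 : smoothstep w = 1 - (1 - w) ^+ 2 * (2 + w) / 2 by rewrite /smoothstep; field.
apply/andP; split.
  rewrite e1 (le_trans vw) // lerDl divr_ge0 // mulr_ge0 // ?(ltW w0) //.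
  by rewrite subr_ge0 expr_le1 // ltW.
by rewrite e2 lerBlDr lerDl divr_ge0 // mulr_ge0 ?sqr_ge0 // addr_ge0 // ltW.
Qed.

Lemma cvg_iter_smoothstep_gt0 v : 0 < v <= 1 -> iter n smoothstep v @[n --> \oo] --> (1 : R).
Proof.
move=> v01; have /andP[v0 v1] := v01.
have H n : 1 - iter n smoothstep v <= (1 - v / 2) ^+ n.
  elim: n => [|n IH]; first by rewrite expr0 /=; lra.
  have /andP[] := iter_smoothstep_itv n v01; rewrite exprS /=.
  move: IH; move: (iter n _ v) => w IH vw w1.
  (* The distance to 1 is multiplied by (1 - w)(2 + w)/2, which is at most 1 - v/2 because w >=
     v. *)
  rewrite (_ : 1 - _ = (1 - w) * ((1 - w) * (2 + w) / 2)); last by rewrite /smoothstep; field.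
  rewrite mulrC ler_pM //; [|lra|nra].
  by rewrite divr_ge0 // mulr_ge0 //; lra.
have c : (1 - (1 - v / 2) ^+ n) @[n --> \oo] --> (1 : R).
  rewrite -[X in _ --> X]subr0; apply: cvgB; first exact: cvg_cst.
  by apply: cvg_expr; rewrite ger0_norm; lra.
apply: (squeeze_cvgr _ c (cvg_cst (1:R))).
by near=> n; rewrite lerBlDr addrC -lerBlDr H; have /andP[] := iter_smoothstep_itv n v01.
Unshelve. all: by end_near. Qed.

Lemma cvg_iter_smoothstep v : -1 <= v <= 1 -> iter n smoothstep v @[n --> \oo] --> Num.sg v.
Proof.
have iN n w : iter n smoothstep (- w) = - iter n smoothstep w.
  by elim: n => //= n ->; rewrite smoothstepN.
move=> /andP[v1 v2]; case: (ltrgtP v 0) => [v0|v0|->].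
- rewrite ltr0_sg // -[v]opprK (_ : (fun n => _) = (fun n => - iter n smoothstep (- v))).
    by apply: cvgN; apply: cvg_iter_smoothstep_gt0; lra.
  by apply/funext => n; rewrite iN.
- by rewrite gtr0_sg //; apply: cvg_iter_smoothstep_gt0; lra.
- rewrite sgr0 (_ : (fun n => _) = (fun=> 0)); first exact: cvg_cst.
  by apply/funext; elim=> //= n ->; rewrite /smoothstep expr0n mulr0 subrr mul0r.
Qed.

Lemma mclosure_smoothstep n f : W f -> W (fun x => iter n smoothstep (f x)).
Proof.
move=> Wf; elim: n => //= n IH.
have W3 := mclosure_mul IH (mclosure_mul IH IH).
have := mclosure_add (mclosure_scale (3 / 2) IH) (mclosure_scale (- 2^-1) W3).
by congr (W _); apply/funext => x; rewrite /smoothstep; field.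
Qed.

(** The sign of [f] is a bounded limit of polynomials in [f], and (s + s^2)/2 sends the signs -1, 0,
    1 to 0, 0, 1. *)
Lemma mclosure_pos f : W f -> (forall x, `|f x| <= 1) -> mclosure_sets [set x | 0 < f x].
Proof.
move=> Wf f1.
have Ws : W (fun x => Num.sg (f x)).
  apply: (mc_lim mW (h := fun n x => iter n smoothstep (f x)) (M := 1)) => [n|n x|x].
  - exact: mclosure_smoothstep.
  - elim: n x => [x|n IH x]; first exact: f1.
    rewrite /=; move: (iter n _ _) (IH x) => w; rewrite !ler_norml => /andP[w0 w1].
    have w2 : w ^+ 2 <= 1 by nra.
    rewrite /smoothstep; nra.
  - by apply: cvg_iter_smoothstep; rewrite -ler_norml.
have := mclosure_scale (2^-1) (mclosure_add Ws (mclosure_mul Ws Ws)).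
congr (W _); apply/funext => x; rewrite indicE.
case: (ltrgtP (f x) 0) => fx.
- by rewrite ltr0_sg // memNset /= ?ltNge ?(ltW fx) //; field.
- by rewrite gtr0_sg // mem_set /= //; field.
- by rewrite fx sgr0 memNset /= ?fx ?ltxx //=; ring.
Qed.

End multiplicative.

End monotone_class.

Import HBNNSimple.

Section monotone_class_measurable.
Context d (X : measurableType d) (R : realType).

Variable B : set (X -> R).
Hypothesis Bgen : measurable `<=` mclosure_sets B.

Lemma mclosure_nnsfun (f : {nnsfun X >-> R}) : mclosure B f.
Proof.
have -> : (f : X -> R) = (fun x => \sum_(y <- fset_set (range f)) y * \1_(f @^-1` [set y]) x).
  by apply/funext => x; rewrite fimfunE fsbig_finite.
apply: mclosure_sum => // y.
by apply: mclosure_scale; apply: Bgen.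
Qed.

Lemma mclosure_bounded_measurable (f : X -> R) (M : R) : measurable_fun setT f ->
  (forall x, `|f x| <= M) -> mclosure B f.
Proof.
move=> mf fM.
(* Adding [M] makes the function nonnegative, so that increasing simple functions approximate it;
   they stay below its bound [2 * M]. *)
have mg : measurable_fun setT (EFin \o (fun x => f x + M)).
  by apply/measurable_EFinP; apply: measurable_funD.
have g0 x : (0 <= (f x + M)%:E)%E.
  by rewrite lee_fin; have := fM x; rewrite ler_norml; lra.
pose h := nnsfun_approx measurableT mg.
have ch x : (h n x : R) @[n --> \oo] --> f x + M.
  by have /fine_cvgP[] := cvg_nnsfun_approx measurableT mg (fun y _ => g0 y) (x := x) I.
have hM n x : `|h n x| <= 2 * M.
  rewrite ger0_norm //; apply: (@le_trans _ _ (f x + M)); last first.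
    by have := fM x; rewrite ler_norml; lra.
  apply: (cvgr_to_ge (ch x)).
  exists n => // m /= nm.
  by have /lefP := nd_nnsfun_approx measurableT mg nm; exact.
have Wg : mclosure B (fun x => f x + M).
  apply: (mc_lim (mclosure_class B) (h := h) (M := 2 * M)) => // n.
  exact: mclosure_nnsfun.
have := mclosure_add Wg (mclosure_cst (- M)).
by congr (mclosure B _); apply/funext => x; ring.
Qed.

End monotone_class_measurable.

(** * Weyl sums along Folner sequences *)

Lemma eq_cvgn (R : realType) (u v : nat -> R) (l : R) : (forall n, u n = v n) ->
  u n @[n --> \oo] --> l -> v n @[n --> \oo] --> l.
Proof. by move=> /funext ->. Qed.

Lemma cvg_sum_seq (R : realType) (I : Type) (s : seq I) (f : I -> nat -> R) (l : I -> R) :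
  (forall i, f i N @[N --> \oo] --> l i) -> \sum_(i <- s) f i N @[N --> \oo] --> \sum_(i <- s) l i.
Proof.
by move=> fl; apply: cvg_big => //; exact: add_continuous.
Qed.

(** * Trigonometric functions of period one *)

Section unit_period.
Variable R : realType.
Implicit Types x y t : R.

Definition ucos x : R := cos (2 * pi * x).
Definition usin x : R := sin (2 * pi * x).

Lemma ucosD x y : ucos (x + y) = ucos x * ucos y - usin x * usin y.
Proof. by rewrite /ucos mulrDr cosD. Qed.

Lemma usinD x y : usin (x + y) = usin x * ucos y + ucos x * usin y.
Proof. by rewrite /usin mulrDr sinD. Qed.

Lemma ucosN x : ucos (- x) = ucos x.
Proof. by rewrite /ucos mulrN cosN. Qed.

Lemma usinN x : usin (- x) = - usin x.
Proof. by rewrite /usin mulrN sinN. Qed.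

Lemma ucosB x y : ucos (x - y) = ucos x * ucos y + usin x * usin y.
Proof. by rewrite ucosD ucosN usinN mulrN opprK. Qed.

Lemma usinB x y : usin (x - y) = usin x * ucos y - ucos x * usin y.
Proof. by rewrite usinD ucosN usinN mulrN. Qed.

Lemma ucos0 : ucos 0 = 1.
Proof. by rewrite /ucos mulr0 cos0. Qed.

Lemma ucos_max x : `|ucos x| <= 1. Proof. exact: cos_max. Qed.
Lemma usin_max x : `|usin x| <= 1. Proof. exact: sin_max. Qed.

Lemma ucos2Dusin2 x : ucos x ^+ 2 + usin x ^+ 2 = 1.
Proof. exact: cos2Dsin2. Qed.

Lemma ucosDint x (m : int) : ucos (x + m%:~R) = ucos x.
Proof.
have H (n : nat) y : ucos (y + n%:R) = ucos y.
  rewrite /ucos -[RHS](periodicn (@cosD2pi R) n); congr cos.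
  by rewrite -(mulr_natr _ n) -(mulr_natr pi 2); ring.
case: m => n; first exact: H.
by rewrite NegzE mulrNz -[LHS](H n.+1) subrK.
Qed.

Lemma ucosDhalf x : ucos (x + 2^-1) = - ucos x.
Proof.
rewrite /ucos -[RHS]cosDpi; congr cos.
by field.
Qed.

(** Sines are cosines shifted by a quarter period, so the cosine alone is carried over to the
    circle. *)
Lemma usinE x : usin x = ucos (x - 4^-1).
Proof.
rewrite /ucos /usin -cosBpihalf; congr cos.
by field.
Qed.

Lemma usin_gt0 x : 0 < x < 2^-1 -> 0 < usin x.
Proof.
move=> x01; have p := pi_gt0 R; apply: sin_gt0_pi.
by apply/andP; split; nra.
Qed.

(** This is the denominator in [weyl1]. If it vanished, the cosine would be 1 at the fractional part
    of [t], which lies strictly between 0 and 1. *)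
Lemma usin_half_neq0 t : t \isn't a Num.int -> usin (t / 2) != 0.
Proof.
move=> tZ; apply/negP => /eqP s0.
have c1 : ucos t = 1.
  rewrite (_ : t = t / 2 + t / 2); last by field.
  by rewrite ucosD s0; have := ucos2Dusin2 (t / 2); rewrite s0; lra.
pose f := t - (Num.floor t)%:~R.
have /andP[f0 f1] : 0 < f < 1.
  have /andP[a b] := Num.Theory.floor_itv t.
  rewrite /f subr_gt0 ltrBlDr addrC -intrD1 b andbT lt_neqAle a andbT.
  by apply: contra tZ => /eqP <-; exact: intr_int.
have cf : ucos f = 1 by rewrite /f -mulrNz ucosDint.
have : 0 < usin (f / 2) by apply: usin_gt0; lra.
have : ucos f = 1 - 2 * usin (f / 2) ^+ 2.
  rewrite {1}(_ : f = f / 2 + f / 2); last by field.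
  by rewrite ucosD; have := ucos2Dusin2 (f / 2); lra.
by rewrite cf; nra.
Qed.

Lemma ucosM x y : ucos x * ucos y = (ucos (x + y) + ucos (x - y)) / 2.
Proof. by rewrite ucosD ucosB; field. Qed.

Lemma measurable_ucos : measurable_fun setT ucos.
Proof.
apply: (measurableT_comp (f := @cos R)).
  by apply: continuous_measurable_fun; exact: continuous_cos.
exact: mulrl_measurable.
Qed.

End unit_period.

Section folner_averages.
Variable R : realType.
Implicit Types (Phi : nat -> {fset int}) (u v : int -> R).

Lemma ler_norm_sum_seq (s : seq int) u M : (forall n, `|u n| <= M) ->
  `|\sum_(n <- s) u n| <= M * (size s)%:R.
Proof.
move=> uM; elim: s => [|n s IH]; first by rewrite big_nil normr0 mulr0.
rewrite big_cons /= -natr1 mulrDr mulr1 addrC.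
by rewrite (le_trans (ler_normD _ _)) // lerD.
Qed.

Lemma fset_sum_diff u M (A B : {fset int}) : (forall n, `|u n| <= M) ->
  `|\sum_(n <- A) u n - \sum_(n <- B) u n| <= M * #|` symdiff_fset A B|%:R.
Proof.
move=> uM; rewrite (big_fsetID _ (mem B) A) (big_fsetID _ (mem A) B) /=.
have -> : [fset x in A | x \in B]%fset = [fset x in B | x \in A]%fset.
  by apply/fsetP => x; rewrite !inE andbC.
have -> : [fset x in A | x \notin B]%fset = (A `\` B)%fset.
  by apply/fsetP => x; rewrite !inE andbC.
have -> : [fset x in B | x \notin A]%fset = (B `\` A)%fset.
  by apply/fsetP => x; rewrite !inE andbC.
rewrite opprD addrACA subrr add0r (le_trans (ler_normB _ _)) //.
rewrite /symdiff_fset cardfsU.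
have -> : ((A `\` B) `&` (B `\` A) = fset0)%fset.
  by apply/fsetP => x; rewrite !inE; case: (x \in A); case: (x \in B).
rewrite cardfs0 subn0 natrD mulrDr.
by apply: lerD; exact: ler_norm_sum_seq.
Qed.

Definition favg (A : {fset int}) u : R := #|` A|%:R^-1 * \sum_(n <- A) u n.

Lemma favgD A u v : favg A (fun n => u n + v n) = favg A u + favg A v.
Proof. by rewrite /favg big_split mulrDr. Qed.

Lemma favgZ A a u : favg A (fun n => a * u n) = a * favg A u.
Proof. by rewrite /favg -mulr_sumr mulrCA. Qed.

Lemma favgB A u v : favg A (fun n => u n - v n) = favg A u - favg A v.
Proof. by rewrite /favg sumrB mulrBr. Qed.

Lemma favg_sum A (I : Type) (s : seq I) (F : I -> int -> R) :
  favg A (fun n => \sum_(i <- s) F i n) = \sum_(i <- s) favg A (F i).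
Proof. by rewrite /favg exchange_big /= mulr_sumr. Qed.

Lemma favg_cst A a : A != fset0 -> favg A (fun=> a) = a.
Proof.
move=> A0; rewrite /favg big_const_seq count_predT iter_addr addr0.
rewrite -[a *+ _]mulr_natr mulrCA mulVf ?mulr1 // pnatr_eq0.
by rewrite cardfs_eq0.
Qed.

Lemma favg_le A u v : (forall n, u n <= v n) -> favg A u <= favg A v.
Proof.
by move=> uv; rewrite ler_wpM2l ?invr_ge0 // ler_sum.
Qed.

Lemma favg_norm A u M : 0 <= M -> (forall n, `|u n| <= M) -> `|favg A u| <= M.
Proof.
move=> M0 uM; rewrite normrM ger0_norm ?invr_ge0 //.
have [->|A0] := eqVneq A fset0; first by rewrite cardfs0 invr0 mul0r.
have c0 : 0 < #|` A|%:R :> R by rewrite ltr0n lt0n cardfs_eq0.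
rewrite ler_pdivrMl // mulrC; exact: ler_norm_sum_seq.
Qed.

(** The variance of [u] over [A] is nonnegative; for empty [A] both sides are 0, the inverse of 0
    being 0. *)
Lemma favg_sqr A u : favg A u ^+ 2 <= favg A (fun n => u n ^+ 2).
Proof.
have [->|A0] := eqVneq A fset0.
  by rewrite /favg cardfs0 invr0 !mul0r expr0n.
set m := favg A u.
have : 0 <= favg A (fun n => (u n - m) ^+ 2).
  by rewrite mulr_ge0 ?invr_ge0 // sumr_ge0 // => n _; rewrite sqr_ge0.
rewrite (_ : (fun n => _) = (fun n => u n ^+ 2 + ((- 2 * m) * u n + m ^+ 2))); last first.
  by apply/funext => n; ring.
by rewrite !favgD favgZ favg_cst // -/m; lra.
Qed.

Variable Phi : nat -> {fset int}.
Hypothesis folPhi : folner R Phi.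

Lemma favg_shift u M h : (forall n, `|u n| <= M) ->
  favg (Phi N) (fun n => u (h + n)) - favg (Phi N) u @[N --> \oo] --> (0 : R).
Proof.
move=> uM; apply/cvgr0Pnorm_lt => e e0.
have M0 : 0 <= M := le_trans (normr_ge0 _) (uM 0).
(* The bound [M] may be 0, whereas [M + 1] can be divided by. *)
have M1 : 0 < M + 1 by rewrite ltr_wpDl.
have /cvgr0Pnorm_lt/(_ (e / (M + 1)) (divr_gt0 e0 M1)) := folPhi.2 h.
apply: filterS => N; rewrite ltr_pdivlMr //; apply: le_lt_trans.
rewrite /favg -mulrBr normrM ger0_norm ?invr_ge0 //.
rewrite (@ger0_norm _ (_ / _)) ?divr_ge0 //.
rewrite [leLHS]mulrC [leRHS]mulrAC ler_wpM2r ?invr_ge0 //.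
have -> : \sum_(n <- Phi N) u (h + n) = \sum_(n <- translate_fset h (Phi N)) u n.
  by rewrite /translate_fset big_imfset //= => ? ? _ _; exact: addrI.
by rewrite (le_trans (fset_sum_diff _ _ uM)) // mulrC ler_wpM2l // lerDl.
Qed.

(** Once the symmetric difference with the translate by 1 has an element, the inverse of the
    cardinality is at most the Folner ratio. *)
Lemma folner_card : (#|` Phi N|%:R : R)^-1 @[N --> \oo] --> (0 : R).
Proof.
apply/cvgr0Pnorm_lt => e e0.
have /cvgr0Pnorm_lt/(_ e e0) := folPhi.2 1.
apply: filterS => N; apply: le_lt_trans.
rewrite !ger0_norm ?invr_ge0 ?divr_ge0 //.
rewrite -[leLHS]mul1r ler_wpM2r ?invr_ge0 // ler1n lt0n cardfs_eq0.
apply/negP => /eqP D0.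
(* Otherwise the set is invariant under translation by 1, hence infinite. *)
have T : translate_fset 1 (Phi N) = Phi N.
  apply/fsetP => x; have : x \notin symdiff_fset (translate_fset 1 (Phi N)) (Phi N).
    by rewrite D0.
  by rewrite !inE; case: (x \in Phi N); case: (x \in translate_fset _ _).
have /fset0Pn[n0 n0P] := folPhi.1 N.
have inP k : n0 + k%:Z \in Phi N.
  elim: k => [|k IH]; first by rewrite addr0.
  by rewrite -T; apply/imfsetP; exists (n0 + k%:Z) => //=; rewrite addrCA -intS.
pose s := [seq n0 + k%:Z | k <- iota 0 (#|` Phi N|).+1].
have us : uniq s by rewrite map_inj_uniq ?iota_uniq // => a b /addrI[].
have : (size s <= size (enum_fset (Phi N)))%N.
  by apply: uniq_leq_size us _ => x /mapP[k _ ->].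
by rewrite size_map size_iota ltnn.
Qed.

Section van_der_corput.
Variable q : int -> R.
Hypothesis qH : forall h h' : nat, h != h' ->
  favg (Phi N) (fun n => ucos (q (h%:Z + n) - q (h'%:Z + n))) @[N --> \oo] --> (0 : R).

(** Averaging the summand over a window of [H] shifts changes the Folner average by o(1). By
    convexity the square of the result is at most the average of the squared modulus of the window
    mean, in which only the [H] diagonal correlations survive: the limit is 1/H. *)
Lemma van_der_corput :
  favg (Phi N) (fun n => ucos (q n)) @[N --> \oo] --> (0 : R).
Proof.
apply/cvgr0Pnorm_lt => e e0.
have [H H1 He] : exists2 H : nat, (0 < H)%N & 2 / H%:R < e ^+ 2 :> R.
  exists (Num.truncn (2 / e ^+ 2)).+1 => //.
  rewrite ltr_pdivrMr // mulrC -ltr_pdivrMr ?exprn_gt0 //.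
  exact: truncnS_gt.
have H0 : 0 < H%:R :> R by rewrite ltr0n.
pose C n := H%:R^-1 * \sum_(h < H) ucos (q (h%:Z + n)).
(* The sine mean completes the squared modulus: [C n ^+ 2 + S n ^+ 2] expands into cosines of
   differences of phases, which are what [qH] controls. *)
pose S n := H%:R^-1 * \sum_(h < H) usin (q (h%:Z + n)).
pose D N := favg (Phi N) C - favg (Phi N) (fun n => ucos (q n)).
pose E N := favg (Phi N) (fun n => C n ^+ 2 + S n ^+ 2).
have cD : D N @[N --> \oo] --> (0 : R).
  have -> : D = fun N => H%:R^-1 * \sum_(h < H)
      (favg (Phi N) (fun n => ucos (q (h%:Z + n))) - favg (Phi N) (fun n => ucos (q n))).
    apply/funext => N; rewrite /D /C favgZ favg_sum sumrB mulrBr; congr (_ - _).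
    by rewrite sumr_const card_ord -[X in _ * X]mulr_natl mulrA mulVf ?mul1r // gt_eqF.
  rewrite -[X in _ --> X](mulr0 H%:R^-1); apply: cvgMl_tmp.
  rewrite [X in _ --> X](_ : 0 = \sum_(h < H) (0 : R)); last by rewrite big1.
  apply: cvg_sum_seq => h.
  apply: (@favg_shift (fun n => ucos (q n)) 1) => n; exact: ucos_max.
have cE : E N @[N --> \oo] --> (H%:R^-1 : R).
  have -> : E = fun N => H%:R^-2 * \sum_(h < H) \sum_(h' < H)
      favg (Phi N) (fun n => ucos (q (h%:Z + n) - q (h'%:Z + n))).
    apply/funext => N; rewrite /E.
    rewrite (_ : (fun n => _) = (fun n => H%:R^-2 * \sum_(h < H) \sum_(h' < H)
       ucos (q (h%:Z + n) - q (h'%:Z + n)))); last first.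
      apply/funext => n; rewrite /C /S !exprMn -mulrDr exprVn; congr (_ * _).
      rewrite !expr2 !big_distrlr /= -big_split; apply: eq_bigr => h _.
      by rewrite -big_split; apply: eq_bigr => h' _; rewrite ucosB.
    by rewrite favgZ favg_sum; congr (_ * _); apply: eq_bigr => h _; rewrite favg_sum.
  have -> : (H%:R^-1 : R) = H%:R^-2 * \sum_(h < H) \sum_(h' < H) (h == h')%:R.
    rewrite (eq_bigr (fun=> 1)) => [|h _]; last first.
      by rewrite (bigD1 h) //= eqxx big1 ?addr0 // => j /negPf; rewrite eq_sym => ->.
    rewrite sumr_const card_ord -[X in _ * X]mulr_natl mulr1 expr2 invfM.
    by rewrite mulrAC mulVf ?mul1r // gt_eqF.
  apply: cvgMl_tmp; apply: cvg_sum_seq => h.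
  apply: cvg_sum_seq => h'.
  have [->|hh'] := eqVneq h h'; last by apply: qH.
  apply: cvg_near_cst; near=> N.
  rewrite (_ : (fun n => _) = (fun=> 1)); first by rewrite favg_cst // folPhi.1.
  by apply/funext => n; rewrite subrr ucos0.
have c2 : 2 * D N ^+ 2 + 2 * E N @[N --> \oo] --> (2 / H%:R : R).
  rewrite -[X in _ --> X]add0r; apply: cvgD; last exact: cvgMl_tmp.
  rewrite -[X in _ --> X](mulr0 2); apply: cvgMl_tmp.
  rewrite -[X in _ --> X](mulr0 (0 : R)) (_ : (fun x => _) = D \* D); first exact: cvgM.
  by apply/funext => N; rewrite expr2.
have cc : \forall N \near \oo, 2 * D N ^+ 2 + 2 * E N < e ^+ 2.
  exact: (cvgr_lt _ c2 _ He).
apply: filterS cc => N ltN.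
set x := favg _ _.
suff : `|x| ^+ 2 < e ^+ 2 by rewrite ltr_pXn2r // nnegrE ltW.
rewrite real_normK ?num_real //; apply: le_lt_trans ltN.
have -> : x = favg (Phi N) C - D N by rewrite /D -/x; ring.
have CE : favg (Phi N) C ^+ 2 <= E N.
  apply: (le_trans (favg_sqr _ _)); apply: favg_le => n.
  by rewrite lerDl sqr_ge0.
(* The inequality (a - b)^2 <= 2 a^2 + 2 b^2 is the nonnegativity of (a + b)^2. *)
have := sqr_ge0 (favg (Phi N) C + D N); move: CE.
by move: (favg _ C) (D N) => a b; nra.
Unshelve. all: by end_near. Qed.

End van_der_corput.

(** Multiplied by twice the sine of the half step, the summand becomes a difference
    [u (1 + n) - u n], whose averages vanish by approximate invariance under the shift by 1. *)
Lemma weyl1 (a b : R) : a \isn't a Num.int ->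
  favg (Phi N) (fun n => ucos (a * n%:~R + b)) @[N --> \oo] --> (0 : R).
Proof.
move=> aZ; have s0 := usin_half_neq0 aZ.
pose u n := usin (a * n%:~R + b - a / 2).
have := @favg_shift u 1 1 (fun n => usin_max _).
move=> /(@cvgMl_tmp _ _ _ _ _ (2 * usin (a / 2))^-1 _); rewrite mulr0.
apply: eq_cvgn => N.
rewrite -favgB -favgZ /u; congr favg; apply/funext => n.
rewrite (_ : a * (1 + n)%:~R + b - a / 2 = a * n%:~R + b + a / 2); last first.
  by rewrite intrD; field.
by rewrite usinD usinB; field.
Qed.

Definition irr (a : R) := forall m : int, m != 0 -> m%:~R * a \isn't a Num.int.

Lemma irr_mulz a (m : int) : irr a -> m != 0 -> irr (m%:~R * a).
Proof. by move=> ia m0 k k0; rewrite mulrA -intrM; apply: ia; rewrite mulf_neq0. Qed.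

(** Differencing leaves a linear phase with slope 2 (h - h') a, which is not an integer when h and
    h' differ. *)
Lemma weyl2 (a b c : R) : irr a ->
  favg (Phi N) (fun n => ucos (a * n%:~R ^+ 2 + b * n%:~R + c)) @[N --> \oo] --> (0 : R).
Proof.
move=> ia; apply: (@van_der_corput (fun n => a * n%:~R ^+ 2 + b * n%:~R + c)) => h h' hh'.
have hh : 2 * (h%:Z - h'%:Z) != 0 by rewrite mulf_neq0 // subr_eq0.
have := weyl1 (a * (h%:R ^+ 2 - h'%:R ^+ 2) + b * (h%:R - h'%:R)) (ia _ hh).
apply: eq_cvgn => N; congr favg; apply/funext => n; congr ucos.
by rewrite !(intrD, intrM, mulrNz) /=; ring.
Qed.

(** Differencing leaves a quadratic phase with leading coefficient 3 (h - h') a, still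
    irrational. *)
Lemma weyl3 (a b c d : R) : irr a ->
  favg (Phi N) (fun n => ucos (a * n%:~R ^+ 3 + b * n%:~R ^+ 2 + c * n%:~R + d))
    @[N --> \oo] --> (0 : R).
Proof.
move=> ia.
apply: (@van_der_corput (fun n => a * n%:~R ^+ 3 + b * n%:~R ^+ 2 + c * n%:~R + d)) => h h' hh'.
have hh : 3 * (h%:Z - h'%:Z) != 0 by rewrite mulf_neq0 // subr_eq0.
have := weyl2 (3 * a * (h%:R ^+ 2 - h'%:R ^+ 2) + 2 * b * (h%:R - h'%:R))
  (a * (h%:R ^+ 3 - h'%:R ^+ 3) + b * (h%:R ^+ 2 - h'%:R ^+ 2) + c * (h%:R - h'%:R))
  (irr_mulz ia hh).
apply: eq_cvgn => N; congr favg; apply/funext => n; congr ucos.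
by rewrite !(intrD, intrM, mulrNz) /=; ring.
Qed.

End folner_averages.

(** * Mean ergodic averages *)

Section bounded_measurable.
Context (R : realType) d (X : measurableType d) (mu : probability X R).
Implicit Types f g : X -> R.

(** The bound holds everywhere, as the bounded pointwise limits of [monotone_class] require;
    [Lfun_oo_bounded] supplies such representatives of essentially bounded functions. *)
Definition bounded_measurable f :=
  measurable_fun setT f /\ exists M : R, forall x, `|f x| <= M.

Lemma bounded_measurable_integrable f :
  bounded_measurable f -> mu.-integrable setT (EFin \o f).
Proof.
move=> [mf [M fM]]; apply: measurable_bounded_integrable => //.
  by rewrite -ge0_fin_numE // fin_num_measure.
exists M; split; first exact: num_real.
by move=> y My x _; exact: le_trans (fM x) (ltW My).
Qed.

Lemma bounded_measurableD f g : bounded_measurable f -> bounded_measurable g ->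
  bounded_measurable (fun x => f x + g x).
Proof.
move=> [mf [M fM]] [mg [N gN]]; split; first exact: measurable_funD.
by exists (M + N) => x; rewrite (le_trans (ler_normD _ _)) // lerD.
Qed.

Lemma bounded_measurableM f g : bounded_measurable f -> bounded_measurable g ->
  bounded_measurable (fun x => f x * g x).
Proof.
move=> [mf [M fM]] [mg [N gN]]; split; first exact: measurable_funM.
by exists (M * N) => x; rewrite normrM ler_pM.
Qed.

Lemma bounded_measurable_cst a : bounded_measurable (fun=> a).
Proof. by split; [exact: measurable_cst|exists `|a|]. Qed.

Lemma bounded_measurableZ a f : bounded_measurable f -> bounded_measurable (fun x => a * f x).
Proof. by move=> bf; apply: bounded_measurableM => //; exact: bounded_measurable_cst. Qed.

Lemma bounded_measurableB f g : bounded_measurable f -> bounded_measurable g ->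
  bounded_measurable (fun x => f x - g x).
Proof.
move=> bf bg; have := bounded_measurableD bf (bounded_measurableZ (-1) bg).
by congr bounded_measurable; apply/funext => x; rewrite mulN1r.
Qed.

Lemma bounded_measurable_norm f : bounded_measurable f -> bounded_measurable (fun x => `|f x|).
Proof.
move=> [mf [M fM]]; split; first exact: measurableT_comp.
by exists M => x; rewrite normr_id.
Qed.

Lemma bounded_measurable_comp f (S : X -> X) : bounded_measurable f ->
  measurable_fun setT S -> bounded_measurable (fun x => f (S x)).
Proof.
by move=> [mf [M fM]] mS; split; [exact: measurableT_comp|exists M].
Qed.

Lemma bounded_measurable_sum (I : Type) (s : seq I) (F : I -> X -> R) :
  (forall i, bounded_measurable (F i)) ->
  bounded_measurable (fun x => \sum_(i <- s) F i x).
Proof.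
move=> bF; elim: s => [|i s IH].
  by under eq_fun do rewrite big_nil; exact: bounded_measurable_cst.
by under eq_fun do rewrite big_cons; exact: bounded_measurableD.
Qed.

Definition mean f : R := \int[mu]_x f x.

Lemma mean_cst a : mean (fun=> a) = a.
Proof.
rewrite /mean Rintegral_cst //; have := probability_setT mu => /= ->.
by rewrite mulr1.
Qed.

Lemma meanD f g : bounded_measurable f -> bounded_measurable g ->
  mean (fun x => f x + g x) = mean f + mean g.
Proof. by move=> bf bg; apply: RintegralD => //; exact: bounded_measurable_integrable. Qed.

Lemma meanZ a f : bounded_measurable f -> mean (fun x => a * f x) = a * mean f.
Proof. by move=> bf; apply: RintegralZl => //; exact: bounded_measurable_integrable. Qed.

Lemma meanB f g : bounded_measurable f -> bounded_measurable g ->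
  mean (fun x => f x - g x) = mean f - mean g.
Proof. by move=> bf bg; apply: RintegralB => //; exact: bounded_measurable_integrable. Qed.

Lemma le_mean f g : bounded_measurable f -> bounded_measurable g ->
  (forall x, f x <= g x) -> mean f <= mean g.
Proof. by move=> bf bg fg; apply: le_Rintegral => //; exact: bounded_measurable_integrable. Qed.

Lemma mean_ge0 f : (forall x, 0 <= f x) -> 0 <= mean f.
Proof. by move=> f0; apply: Rintegral_ge0. Qed.

Lemma norm_mean f : bounded_measurable f -> `|mean f| <= mean (fun x => `|f x|).
Proof. by move=> bf; apply: le_normr_Rintegral => //; exact: bounded_measurable_integrable. Qed.

Lemma mean_sum (I : Type) (s : seq I) (F : I -> X -> R) :
  (forall i, bounded_measurable (F i)) ->
  mean (fun x => \sum_(i <- s) F i x) = \sum_(i <- s) mean (F i).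
Proof.
move=> bF; elim: s => [|i s IH].
  by under eq_fun do rewrite big_nil; rewrite mean_cst big_nil.
under eq_fun do rewrite big_cons.
by rewrite meanD ?IH ?big_cons //; exact: bounded_measurable_sum.
Qed.

Lemma mean_EFin f : bounded_measurable f -> (\int[mu]_x (f x)%:E)%E = (mean f)%:E.
Proof.
move=> bf; rewrite /mean /Rintegral fineK //.
by apply: integrable_fin_num => //; exact: bounded_measurable_integrable.
Qed.

Lemma mean_preserving f (S : X -> X) : bounded_measurable f ->
  measure_preserving mu S -> mean (fun x => f (S x)) = mean f.
Proof.
move=> bf [mS muS]; rewrite /mean /Rintegral; congr fine.
have mf : measurable_fun setT (EFin \o f) by apply/measurable_EFinP; exact: bf.1.
have := @integral_pushforward _ _ X X R S mS mu setT (EFin \o f) mf.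
rewrite preimage_setT => <- //.
  by apply: eq_measure_integral => A mA _; rewrite /= /pushforward muS.
exact: (bounded_measurable_integrable (bounded_measurable_comp bf mS)).
Qed.

Lemma cvg_mean (h : nat -> X -> R) f M :
  (forall n, measurable_fun setT (h n)) -> (forall n x, `|h n x| <= M) ->
  (forall x, h n x @[n --> \oo] --> f x) -> mean (h n) @[n --> \oo] --> mean f.
Proof.
move=> mh hM hf.
have bh n : bounded_measurable (h n) by split=> //; exists M.
have bf : bounded_measurable f.
  split; last by exists M => x; exact: (@limr_norm_le _ (h ^~ x)).
  by apply: (measurable_fun_cvg mh) => x _; exact: hf.
have c : (mean (h n))%:E @[n --> \oo] --> (mean f)%:E.
  rewrite -(mean_EFin bf).
  rewrite (_ : (fun n => _) = (fun n => \int[mu]_x (h n x)%:E)%E); last first.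
    by apply/funext => n; rewrite (mean_EFin (bh n)).
  apply: (@dominated_cvg _ _ _ mu setT _ _ _ (fun=> M%:E)) => //.
  - by move=> n; apply/measurable_EFinP.
  - by move=> x _; apply: cvg_EFin; [exact: nearW|exact: hf].
  - exact: (bounded_measurable_integrable (bounded_measurable_cst M)).
  - by move=> n x _; rewrite /= lee_fin.
by have /fine_cvgP[] := c.
Qed.

Lemma cvg_mean_norm (h : nat -> X -> R) f M :
  (forall n, measurable_fun setT (h n)) -> (forall n x, `|h n x| <= M) ->
  measurable_fun setT f ->
  (forall x, h n x @[n --> \oo] --> f x) ->
  mean (fun x => `|h n x - f x|) @[n --> \oo] --> (0 : R).
Proof.
move=> mh hM mf hf; rewrite -(mean_cst 0).
apply: (@cvg_mean (fun n x => `|h n x - f x|) _ (M + M)).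
- by move=> n; apply: measurableT_comp => //; exact: measurable_funB.
- move=> n x; rewrite normr_id (le_trans (ler_normB _ _)) // lerD //.
  exact: (@limr_norm_le _ (h ^~ x)).
- move=> x; rewrite -[X in _ --> X](@normr0 _ R) -(subrr (f x)).
  by apply: cvg_norm; apply: cvgB; [exact: hf|exact: cvg_cst].
Qed.

End bounded_measurable.

(** * The functions with convergent averages form a monotone class *)

Section mean_ergodic.
Context (R : realType) d (X : measurableType d) (mu : probability X R).
Variables (S : int -> X -> X) (Phi : nat -> {fset int}).
Hypothesis mpS : forall n, measure_preserving mu (S n).
Hypothesis folPhi : folner R Phi.

Local Notation bm := (@bounded_measurable R _ X).
Local Notation E := (mean mu).

Lemma favg_bounded_measurable (A : {fset int}) (F : int -> X -> R) :
  (forall n, bm (F n)) -> bm (fun x => favg A (fun n => F n x)).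
Proof. by move=> bF; apply: bounded_measurableZ; exact: bounded_measurable_sum. Qed.

Lemma mean_favg (A : {fset int}) (F : int -> X -> R) :
  (forall n, bm (F n)) -> E (fun x => favg A (fun n => F n x)) = favg A (fun n => E (F n)).
Proof.
move=> bF; rewrite /favg meanZ; last exact: bounded_measurable_sum.
by rewrite mean_sum.
Qed.

Lemma bmS f n : bm f -> bm (fun x => f (S n x)).
Proof. by move=> bf; apply: bounded_measurable_comp => //; exact: (mpS n).1. Qed.

Lemma bm_favgS f A : bm f -> bm (fun x => favg A (fun n => f (S n x))).
Proof. by move=> bf; apply: favg_bounded_measurable => n; exact: bmS. Qed.

(** Convergence is in L^1, where linearity and approximation need only the triangle inequality;
    [ergodic_criterion] upgrades it to L^2. *)
Definition mean_cvg f := bm f /\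
  E (fun x => `|favg (Phi N) (fun n => f (S n x)) - E f|) @[N --> \oo] --> (0 : R).

(** Averaging along measure-preserving maps contracts L^1 by a bound that does not depend on [A];
    this lets the limit in [k] be exchanged with the limit along the Folner sequence. *)
Lemma mean_favg_norm_le f (A : {fset int}) : bm f ->
  A != fset0 -> E (fun x => `|favg A (fun n => f (S n x))|) <= E (fun x => `|f x|).
Proof.
move=> bf A0; have bnf := bounded_measurable_norm bf.
apply: (@le_trans _ _ (E (fun x => favg A (fun n => `|f (S n x)|)))).
  apply: le_mean => [||x].
  - by apply: bounded_measurable_norm; exact: bm_favgS.
  - exact: (bm_favgS A bnf).
  - rewrite /favg normrM ger0_norm ?invr_ge0 // ler_wpM2l ?invr_ge0 //.
    exact: ler_norm_sum.
rewrite (mean_favg _ (F := fun n x => `|f (S n x)|)); last first.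
  by move=> n; exact: (bmS n bnf).
rewrite -[leRHS](favg_cst _ A0) le_eqVlt; apply/orP; left; apply/eqP; congr favg.
by apply/funext => n; rewrite (mean_preserving bnf (mpS n)).
Qed.

Lemma mean_cvg_class : monotone_class mean_cvg.
Proof.
split.
- split; first exact: bounded_measurable_cst.
  apply: cvg_near_cst; near=> N.
  rewrite -[RHS](mean_cst mu 0); congr mean.
  by apply/funext => x; rewrite favg_cst ?folPhi.1 // mean_cst subrr normr0.
- move=> a f g [bf cf] [bg cg].
  have baf := bounded_measurableZ a bf.
  split; first exact: bounded_measurableD.
  have c : `|a| * E (fun x => `|favg (Phi N) (fun n => f (S n x)) - E f|) +
     E (fun x => `|favg (Phi N) (fun n => g (S n x)) - E g|) @[N --> \oo] --> (0 : R).
    rewrite -[X in _ --> X]addr0; apply: cvgD => //.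
    by rewrite -[X in _ --> X](mulr0 `|a|); apply: (cvgMl_tmp cf).
  apply: (squeeze_cvgr _ (cvg_cst 0) c); near=> N.
  have bF : bm (fun x => `|favg (Phi N) (fun n => f (S n x)) - E f|).
    apply: bounded_measurable_norm; apply: bounded_measurableB; first exact: bm_favgS.
    exact: bounded_measurable_cst.
  have bG : bm (fun x => `|favg (Phi N) (fun n => g (S n x)) - E g|).
    apply: bounded_measurable_norm; apply: bounded_measurableB; first exact: bm_favgS.
    exact: bounded_measurable_cst.
  rewrite mean_ge0 //= -meanZ // -meanD //; last exact: bounded_measurableZ.
  apply: le_mean => [||x].
  - apply: bounded_measurable_norm; apply: bounded_measurableB.
      apply: (bm_favgS _ (f := fun x => a * f x + g x)).
      exact: bounded_measurableD.
    exact: bounded_measurable_cst.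
  - by apply: bounded_measurableD => //; exact: bounded_measurableZ.
  rewrite favgD favgZ meanD // meanZ // -normrM.
  apply: le_trans (ler_normD _ _).
  by rewrite le_eqVlt; apply/orP; left; apply/eqP; congr `|_|; ring.
- move=> h f M mch hM hf.
  have bh n := (mch n).1.
  have mf : measurable_fun setT f.
    by apply: (measurable_fun_cvg (fun n => (bh n).1)) => x _; exact: hf.
  have bf : bm f by split=> //; exists M => x; exact: (@limr_norm_le _ (h ^~ x)).
  split=> //; apply/cvgr0Pnorm_lt => e e0.
  have e4 : 0 < e / 4 by rewrite divr_gt0.
  have cD := cvg_mean_norm mu (fun n => (bh n).1) hM mf hf.
  (* A single [h k] close to [f] in L^1 is enough: the error splits into the average of [h k - f],
     the deviation of the averages of [h k], and the difference of the integrals, each below e/4. *)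
  have [k kE] : exists k, E (fun x => `|h k x - f x|) < e / 4.
    have /cvgr0Pnorm_lt/(_ _ e4)[k _ kP] := cD.
    exists k; apply: le_lt_trans (kP k (leqnn _)); exact: ler_norm.
  have /cvgr0Pnorm_lt/(_ _ e4) := (mch k).2; apply: filterS => N.
  have bd : bm (fun x => h k x - f x) by exact: bounded_measurableB.
  rewrite ger0_norm ?mean_ge0 // => NE; rewrite ger0_norm ?mean_ge0 //.
  pose A x := `|favg (Phi N) (fun n => h k (S n x) - f (S n x))|.
  pose B x := `|favg (Phi N) (fun n => h k (S n x)) - E (h k)|.
  have bA : bm A by apply: bounded_measurable_norm; exact: (bm_favgS (Phi N) bd).
  have bB : bm B.
    apply: bounded_measurable_norm; apply: bounded_measurableB; first exact: bm_favgS.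
    exact: bounded_measurable_cst.
  have AE : E A < e / 4 by apply: le_lt_trans (mean_favg_norm_le bd (folPhi.1 N)) kE.
  have hkf : `|E (h k) - E f| < e / 4.
    by rewrite -meanB //; apply: le_lt_trans (norm_mean mu bd) kE.
  apply: (@le_lt_trans _ _ (E (fun x => (A x + B x) + `|E (h k) - E f|))); last first.
    rewrite meanD //; [|exact: bounded_measurableD|exact: bounded_measurable_cst].
    by rewrite meanD // mean_cst; move: NE; rewrite -/B; lra.
  apply: le_mean => [||x].
  - apply: bounded_measurable_norm; apply: bounded_measurableB; first exact: bm_favgS.
    exact: bounded_measurable_cst.
  - apply: bounded_measurableD; first exact: bounded_measurableD.
    exact: bounded_measurable_cst.
  rewrite /A /B favgB; set u := favg _ _; set v := favg _ _.
  have -> : u - E f = (v - E (h k)) - (v - u) + (E (h k) - E f) by ring.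
  rewrite (le_trans (ler_normD _ _)) // lerD2r [leRHS]addrC.
  exact: ler_normB.
Unshelve. all: by end_near. Qed.

End mean_ergodic.

Section torus_cos.
Variable R : realType.
Local Notation T := (torus R).

Definition tcos (z : T) : R := ucos (torus_section z).

Lemma tcos_pi (x : R) : tcos (torus_pi x) = ucos x.
Proof.
have /torus_pi_eq/intrP[m e] : torus_pi (torus_section (torus_pi x)) = torus_pi x.
  exact: torus_sectionK.
by rewrite /tcos -(subrK x (torus_section _)) e addrC ucosDint.
Qed.

Lemma tcos_max z : `|tcos z| <= 1.
Proof. exact: ucos_max. Qed.

Lemma tcosDhalf z : tcos (z + torus_pi 2^-1) = - tcos z.
Proof. by rewrite -(torus_sectionK z) -torus_piD !tcos_pi ucosDhalf. Qed.

Lemma tcosM z w : tcos z * tcos w = (tcos (z + w) + tcos (z - w)) / 2.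
Proof.
rewrite -(torus_sectionK z) -(torus_sectionK w) -torus_piD -torus_piB.
by rewrite !tcos_pi ucosM.
Qed.

Lemma measurable_tcos : measurable_fun [set: T] tcos.
Proof.
by apply: measurableT_comp; [exact: measurable_ucos|exact: measurable_torus_section].
Qed.

Lemma bounded_measurable_tcos d (X : measurableType d) (g : X -> T) :
  measurable_fun setT g -> bounded_measurable (fun x => tcos (g x)).
Proof.
move=> mg; split; first by apply: measurableT_comp => //; exact: measurable_tcos.
by exists 1 => x; exact: tcos_max.
Qed.

(** Divisibility of the circle provides translations that move a given character by exactly one half
    and so reverse its sign. *)
Lemma torus_div (z : T) (m : int) : m != 0 -> exists t, t *~ m = z.
Proof.
move=> m0; exists (torus_pi (m%:~R^-1 * torus_section z)).
by rewrite -torus_piMz mulrA mulfV ?intr_eq0 // mul1r torus_sectionK.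
Qed.

End torus_cos.

(** * Averages of characters *)

Section mean_characters.
Context (R : realType) d (X : measurableType d) (mu : probability X R).
Local Notation E := (mean mu).

(* The integral is equal to its own opposite. *)
Lemma mean_tcos0 (g : X -> torus R) (tau : X -> X) : measurable_fun setT g ->
  measure_preserving mu tau -> (forall x, g (tau x) = g x + torus_pi 2^-1) ->
  E (fun x => tcos (g x)) = 0.
Proof.
move=> mg mt gt; have bg := bounded_measurable_tcos mg.
have := mean_preserving bg mt.
under [X in mean _ X = _ -> _]eq_fun do rewrite gt tcosDhalf -mulN1r.
by rewrite meanZ //; lra.
Qed.

Section orthogonality.
Variables (g : int -> X -> torus R) (bad : rel int) (D : nat).
Hypothesis mg : forall n, measurable_fun setT (g n).
Hypothesis badD : forall n (A : {fset int}), (count (bad n) (enum_fset A) <= D)%N.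
Hypothesis orth : forall n m, ~~ bad n m ->
  E (fun x => tcos (g n x) * tcos (g m x)) = 0.

(** In the expanded square each [n] has at most [D] partners [m] with a nonzero correlation, and
    each correlation is at most 1; of the two averaging factors one remains. *)
Lemma mean_sqr_favg_tcos (A : {fset int}) : A != fset0 ->
  E (fun x => favg A (fun n => tcos (g n x)) ^+ 2) <= D%:R / #|` A|%:R.
Proof.
move=> A0.
have bu n := bounded_measurable_tcos (mg n).
have bm2 n m := bounded_measurableM (bu n) (bu m).
have c0 : 0 < #|` A|%:R :> R by rewrite ltr0n lt0n cardfs_eq0.
have -> : (fun x => favg A (fun n => tcos (g n x)) ^+ 2) =
    (fun x => favg A (fun n => favg A (fun m => tcos (g n x) * tcos (g m x)))).
  apply/funext => x; rewrite expr2 -favgZ; congr favg; apply/funext => n.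
  by rewrite favgZ mulrC.
rewrite (mean_favg mu A
  (F := fun n x => favg A (fun m => tcos (g n x) * tcos (g m x)))); last first.
  by move=> n; exact: (favg_bounded_measurable A (bm2 n)).
rewrite -[leRHS](favg_cst _ A0); apply: favg_le => n.
rewrite (mean_favg mu A (bm2 n)) /favg mulrC ler_pM2r ?invr_gt0 //.
rewrite (bigID (bad n)) /= [X in _ + X]big1 ?addr0; last by move=> m; exact: orth.
apply: (@le_trans _ _ (\sum_(m <- A | bad n m) 1)).
  apply: ler_sum => m _; apply: le_trans (ler_norm _) _.
  apply: le_trans (norm_mean mu (bm2 n m)) _; rewrite -[leRHS](mean_cst mu 1).
  apply: le_mean => [||x]; [exact: bounded_measurable_norm|exact: bounded_measurable_cst|].
  by rewrite normrM -[leRHS]mulr1 ler_pM // tcos_max.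
by rewrite big_const_seq iter_addr addr0 ler_nat.
Qed.

End orthogonality.

Variables (S : int -> X -> X) (Phi : nat -> {fset int}).
Hypothesis mpS : forall n, measure_preserving mu (S n).
Hypothesis folPhi : folner R Phi.

(** The averages have the same integral as [f], so their vanishing in L^1 forces that integral to be
    0. *)
Lemma mean_cvg0 (f : X -> R) : bounded_measurable f ->
  E (fun x => `|favg (Phi N) (fun n => f (S n x))|) @[N --> \oo] --> (0 : R) ->
  mean_cvg mu S Phi f.
Proof.
move=> bf cf; split=> //.
have Ef : E f = 0.
  apply/eqP; rewrite -normr_le0; apply: (cvgr_to_ge cf); near=> N.
  rewrite -(favg_cst (E f) (folPhi.1 N)).
  have -> : (fun=> E f) = (fun n => E (fun x => f (S n x))).
    by apply/funext => n; rewrite (mean_preserving bf (mpS n)).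
  rewrite -(mean_favg mu _ (F := fun n x => f (S n x))) => [|n]; last exact: (bmS mpS n bf).
  exact: (norm_mean mu (bm_favgS mpS (Phi N) bf)).
by apply: eq_cvgn cf => N; congr mean; apply/funext => x; rewrite Ef subr0.
Unshelve. all: by end_near. Qed.

Lemma mean_cvg_pointwise (f : X -> R) : bounded_measurable f ->
  (forall x, favg (Phi N) (fun n => f (S n x)) @[N --> \oo] --> (0 : R)) ->
  mean_cvg mu S Phi f.
Proof.
move=> bf cf; apply: mean_cvg0 => //.
have [M fM] := bf.2.
have c : E (fun x => `|favg (Phi N) (fun n => f (S n x)) - 0|) @[N --> \oo] --> (0 : R).
  apply: (@cvg_mean_norm _ _ _ mu (fun N x => favg (Phi N) (fun n => f (S n x)))
    (fun=> 0) `|M|) => //.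
  - by move=> N; exact: (bm_favgS mpS (Phi N) bf).1.
  - by move=> N x; apply: favg_norm => // n; exact: le_trans (fM _) (ler_norm _).
by apply: eq_cvgn c => N; congr mean; apply/funext => x; rewrite subr0.
Qed.

Lemma mean_cvg_orthogonal (f : X -> R) (D : R) : bounded_measurable f ->
  (forall N, E (fun x => favg (Phi N) (fun n => f (S n x)) ^+ 2) <= D / #|` Phi N|%:R) ->
  mean_cvg mu S Phi f.
Proof.
move=> bf H; apply: mean_cvg0 => //.
have cD : D / #|` Phi N|%:R @[N --> \oo] --> (0 : R).
  by rewrite -[X in _ --> X](mulr0 D); apply: (cvgMl_tmp (folner_card folPhi)).
apply/cvgr0Pnorm_lt => e e0.
have e2 : 0 < e ^+ 2 by rewrite exprn_gt0.
have /cvgr0Pnorm_lt/(_ _ e2) := cD; apply: filterS => N DN.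
pose F x := favg (Phi N) (fun n => f (S n x)).
have bF : bounded_measurable F by exact: (bm_favgS mpS (Phi N) bf).
have bnF := bounded_measurable_norm bF.
rewrite ger0_norm ?mean_ge0 //.
pose m := E (fun x => `|F x|); rewrite -[mean _ _]/m.
have m0 : 0 <= m by exact: mean_ge0.
suff : m ^+ 2 < e ^+ 2 by rewrite ltr_pXn2r ?nnegrE // ltW.
apply: le_lt_trans (le_lt_trans (ler_norm _) DN); apply: le_trans (H N).
(* The variance of [|F|] bounds the L^1 norm by the L^2 norm. *)
have : 0 <= E (fun x => (`|F x| - m) ^+ 2) by apply: mean_ge0 => x; exact: sqr_ge0.
have -> : (fun x => (`|F x| - m) ^+ 2) = (fun x => (F x * F x + (- 2 * m) * `|F x|) + m ^+ 2).
  apply/funext => x; rewrite sqrrB real_normK ?num_real // -mulr_natr; ring.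
have bFF := bounded_measurableM bF bF.
have bZ := bounded_measurableZ (- 2 * m) bnF.
rewrite meanD; [|exact: bounded_measurableD|exact: bounded_measurable_cst].
rewrite meanD // meanZ // mean_cst -/m.
have -> : (fun x => F x * F x) = (fun x => F x ^+ 2) by apply/funext => x; rewrite expr2.
by rewrite -/(E _); nra.
Qed.

End mean_characters.

(** * Ergodicity for complex-valued functions *)

Section complex_averages.
Variable R : realType.
Implicit Types z w : R[i].

Lemma complex_ReD z w : complex.Re (z + w) = complex.Re z + complex.Re w.
Proof. by case: z w => [a b] [c e]. Qed.

Lemma complex_ImD z w : complex.Im (z + w) = complex.Im z + complex.Im w.
Proof. by case: z w => [a b] [c e]. Qed.

Lemma complex_Re_sum (I : Type) (s : seq I) (F : I -> R[i]) :
  complex.Re (\sum_(i <- s) F i) = \sum_(i <- s) complex.Re (F i).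
Proof. by apply: (big_morph _ complex_ReD). Qed.

Lemma complex_Im_sum (I : Type) (s : seq I) (F : I -> R[i]) :
  complex.Im (\sum_(i <- s) F i) = \sum_(i <- s) complex.Im (F i).
Proof. by apply: (big_morph _ complex_ImD). Qed.

Lemma complex_natrV (m : nat) : (m%:R^-1 : R[i]) = (m%:R^-1)%:C%C.
Proof. by rewrite fmorphV rmorph_nat. Qed.

Lemma complex_ReZ (a : R) z : complex.Re (a%:C%C * z) = a * complex.Re z.
Proof. by case: z => [b c] /=; rewrite mul0r subr0. Qed.

Lemma complex_ImZ (a : R) z : complex.Im (a%:C%C * z) = a * complex.Im z.
Proof. by case: z => [b c] /=; rewrite mul0r addr0. Qed.

Lemma complex_Re_favg (A : {fset int}) (F : int -> R[i]) :
  complex.Re (#|` A|%:R^-1 * \sum_(n <- A) F n) = favg A (fun n => complex.Re (F n)).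
Proof. by rewrite complex_natrV complex_ReZ complex_Re_sum. Qed.

Lemma complex_Im_favg (A : {fset int}) (F : int -> R[i]) :
  complex.Im (#|` A|%:R^-1 * \sum_(n <- A) F n) = favg A (fun n => complex.Im (F n)).
Proof. by rewrite complex_natrV complex_ImZ complex_Im_sum. Qed.

Lemma normc_sqr z :
  ComplexField.Normc.normc z ^+ 2 = complex.Re z ^+ 2 + complex.Im z ^+ 2.
Proof. by case: z => a b /=; rewrite sqr_sqrtr // addr_ge0 ?sqr_ge0. Qed.

Lemma complex_normc_ge0 z : 0 <= ComplexField.Normc.normc z.
Proof. by case: z => a b; exact: sqrtr_ge0. Qed.

End complex_averages.

Section ergodic_criterion.
Context (R : realType) d (X : measurableType d) (mu : probability X R).
Local Notation E := (mean mu).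
Local Notation bm := (@bounded_measurable R _ X).

Lemma Lfun_oo_bounded (u : X -> R) : u \in Lfun mu +oo%E ->
  measurable_fun setT u /\ exists2 v, bm v & \forall x \ae mu, u x = v x.
Proof.
rewrite inE => /andP[]; rewrite !inE => /= mu_ .
rewrite /finite_norm unlock /Lnorm /=.
(* The norm with exponent [+oo] is the essential supremum because the whole space has positive
   measure. *)
have muT : mu setT = 1%E := probability_setT mu.
rewrite muT lte01 => fin; split => //.
have [M uM] : exists M : R, \forall x \ae mu, `|u x| <= M.
  by have := ess_sup_inf.ess_supr_bounded (f := fun x => `|u x|) fin.
(* Truncation: the value is set to 0 wherever the essential bound is exceeded. *)
exists (fun x => u x * \1_[set x | `|u x| <= M] x).
  have mA : measurable [set x | `|u x| <= M].
    rewrite (_ : [set x | _] = (fun x => `|u x|) @^-1` `]-oo, M]%classic); last first.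
      by apply/seteqP; split => x /=; rewrite in_itv.
    rewrite -[X in measurable X]setTI.
    by apply: (measurableT_comp (f := @Num.norm R R)) => //.
  split; first by apply: measurable_funM => //; exact: measurable_indic.
  exists `|M| => x; rewrite indicE; case: (boolP (x \in _)) => [|_].
    by rewrite inE /= mulr1 => /le_trans; apply; exact: ler_norm.
  by rewrite mulr0 normr0.
by apply: filterS uM => x uM; rewrite indicE mem_set // mulr1.
Qed.

Lemma ae_preserving (S : X -> X) (P : set X) : measure_preserving mu S ->
  (\forall x \ae mu, P x) -> \forall x \ae mu, P (S x).
Proof.
move=> [mS muS] [Z [mZ Z0 PZ]]; exists (S @^-1` Z); split.
- by rewrite -[X in measurable X]setTI; exact: mS.
- by rewrite -Z0; exact: muS.
- by move=> x /= nP; apply: PZ.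
Qed.

Variable S : int -> X -> X.
Hypothesis mpS : forall n, measure_preserving mu (S n).

Lemma ae_favg (u v : X -> R) (A : {fset int}) : (\forall x \ae mu, u x = v x) ->
  \forall x \ae mu, favg A (fun n => u (S n x)) = favg A (fun n => v (S n x)).
Proof.
move=> uv.
suff : forall s : seq int,
    \forall x \ae mu, \sum_(n <- s) u (S n x) = \sum_(n <- s) v (S n x).
  by move=> /(_ (enum_fset A)); apply: filterS => x; rewrite /favg => ->.
elim=> [|n s IH]; first by apply: nearW => x; rewrite !big_nil.
by apply: filterS2 (ae_preserving (mpS n) uv) IH => x e1 e2; rewrite !big_cons e1 e2.
Qed.

Lemma ergodic_criterion :
  (forall Phi, folner R Phi -> forall f, bm f -> mean_cvg mu S Phi f) ->
  ergodic mu S.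
Proof.
move=> H; split=> // f [/Lfun_oo_bounded[mfr [u bu fu]] /Lfun_oo_bounded[mfi [v bv fv]]].
move=> Phi fPhi.
have [_ cu] := H _ fPhi _ bu; have [_ cv] := H _ fPhi _ bv.
pose F N x := favg (Phi N) (fun n => u (S n x)) - E u.
pose G N x := favg (Phi N) (fun n => v (S n x)) - E v.
have bF N : bm (F N).
  by apply: bounded_measurableB; [exact: bm_favgS|exact: bounded_measurable_cst].
have bG N : bm (G N).
  by apply: bounded_measurableB; [exact: bm_favgS|exact: bounded_measurable_cst].
have [M FM] : exists M, forall N x, `|F N x| <= M.
  have [M uM] := bu.2; exists (`|M| + `|E u|) => N x.
  rewrite (le_trans (ler_normB _ _)) // lerD2r; apply: favg_norm => // n.
  exact: le_trans (uM _) (ler_norm _).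
have [M' GM] : exists M, forall N x, `|G N x| <= M.
  have [M' vM] := bv.2; exists (`|M'| + `|E v|) => N x.
  rewrite (le_trans (ler_normB _ _)) // lerD2r; apply: favg_norm => // n.
  exact: le_trans (vM _) (ler_norm _).
have Eu : \int[mu]_x complex.Re (f x) = E u.
  congr fine; apply: ae_eq_integral => //; try exact/measurable_EFinP.
    by apply/measurable_EFinP; exact: bu.1.
  by apply: filterS fu => x -> _.
have Ev : \int[mu]_x complex.Im (f x) = E v.
  congr fine; apply: ae_eq_integral => //; try exact/measurable_EFinP.
    by apply/measurable_EFinP; exact: bv.1.
  by apply: filterS fv => x -> _.
pose W N x := F N x ^+ 2 + G N x ^+ 2.
have bW N : bm (W N).
  rewrite (_ : W N = fun x => F N x * F N x + G N x * G N x).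
    by apply: bounded_measurableD; exact: bounded_measurableM.
  by apply/funext => x; rewrite -!expr2.
have normE N : ('N[mu]_(2%:E) [(fun x => (ComplexField.Normc.normc
     (#|` Phi N|%:R^-1 * \sum_(n <- Phi N) f (S n x) - cintegral mu f))%:E)]
   = (Num.sqrt (E (W N)))%:E)%E.
  rewrite unlock /Lnorm.
  have -> : (\int[mu]_x (`|(ComplexField.Normc.normc
     (#|` Phi N|%:R^-1 * \sum_(n <- Phi N) f (S n x) - cintegral mu f))%:E| `^ 2)
     = \int[mu]_x (W N x)%:E)%E.
    (* [V] is the squared distance for [f] itself; it agrees almost everywhere with [W], which is
       computed from the bounded representatives. *)
    pose V x := (favg (Phi N) (fun n => complex.Re (f (S n x))) - E u) ^+ 2 +
       (favg (Phi N) (fun n => complex.Im (f (S n x))) - E v) ^+ 2.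
    transitivity (\int[mu]_x (V x)%:E)%E.
      apply: eq_integral => x _.
      rewrite abse_EFin poweR_EFin ger0_norm; last exact: complex_normc_ge0.
      rewrite powR_mulrn; last exact: complex_normc_ge0.
      rewrite normc_sqr complex_ReD complex_ImD complex_Re_favg complex_Im_favg.
      by rewrite /cintegral /= Eu Ev.
    have mS (g : X -> R) : measurable_fun setT g ->
        measurable_fun setT (fun x => favg (Phi N) (fun n => g (S n x))).
      move=> mg; apply: measurable_funM => //; apply: measurable_sum => n.
      by apply: measurableT_comp => //; exact: (mpS n).1.
    apply: ae_eq_integral => //.
    - apply/measurable_EFinP; rewrite /V; apply: measurable_funD; apply: measurable_funX;
        apply: measurable_funB => //; [exact: (mS _ mfr)|exact: (mS _ mfi)].
    - by apply/measurable_EFinP; exact: (bW N).1.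
    - apply: filterS2 (ae_favg (Phi N) fu) (ae_favg (Phi N) fv) => x e1 e2 _.
      by rewrite /V e1 e2.
  by rewrite mean_EFin // poweR_EFin powR12_sqrt // mean_ge0 // => x; rewrite addr_ge0 ?sqr_ge0.
rewrite /cvg_L2 (_ : (fun N => _) = (fun N => (Num.sqrt (E (W N)))%:E)); last exact/funext.
apply: cvg_EFin; first exact: nearW.
rewrite -[X in _ --> X](@sqrtr0 R).
apply: (cvg_comp (fun N => E (W N)) (@Num.sqrt R)); last exact: sqrt_continuous.
(* The uniform bounds turn L^1 into L^2: F^2 <= M |F| and G^2 <= M' |G|. *)
have c : M * E (fun x => `|F N x|) + M' * E (fun x => `|G N x|) @[N --> \oo] --> (0 : R).
  have c0 : 0 = M * 0 + M' * 0 :> R by rewrite !mulr0 addr0.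
  rewrite [X in _ --> X]c0.
  by apply: cvgD; [apply: (cvgMl_tmp cu)|apply: (cvgMl_tmp cv)].
apply: (squeeze_cvgr _ (cvg_cst 0) c); near=> N.
rewrite mean_ge0 => [|x]; last by rewrite addr_ge0 ?sqr_ge0.
have bFN := bounded_measurable_norm (bF N); have bGN := bounded_measurable_norm (bG N).
rewrite -!meanZ // -meanD //; try exact: bounded_measurableZ.
apply: le_mean => // [|x].
  by apply: bounded_measurableD; exact: bounded_measurableZ.
rewrite /W -[F N x ^+ 2]real_normK ?num_real // -[G N x ^+ 2]real_normK ?num_real //.
by rewrite !expr2 lerD // ler_wpM2r.
Unshelve. all: by end_near. Qed.

End ergodic_criterion.

(** * Characters generate the Borel sets *)

Section preimage_sigma.
Context (X : Type) (G : set (set X)).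
Hypothesis sG : sigma_algebra setT G.

Let G0 : G set0. Proof. by have [] := sG. Qed.
Let GC A : G A -> G (~` A). Proof. by have [_ h _] := sG => /h; rewrite setTD. Qed.
Let GU (A : (set X)^nat) : (forall n, G (A n)) -> G (\bigcup_n A n).
Proof. by have [_ _ h] := sG; exact: h. Qed.

Lemma preimage_sigma_algebra (Y : Type) (h : X -> Y) :
  sigma_algebra setT [set A | G (h @^-1` A)].
Proof.
split => /=.
- by rewrite preimage_set0.
- by move=> A /GC; rewrite setTD preimage_setC.
- by move=> A GA; rewrite preimage_bigcup; exact: GU.
Qed.

Lemma preimage_pair_sigma_algebra d1 d2 (Y1 : measurableType d1)
    (Y2 : measurableType d2) (h : X -> Y1) (k : X -> Y2) :
  (forall A, measurable A -> G (h @^-1` A)) ->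
  (forall A, measurable A -> G (k @^-1` A)) ->
  forall C : set (Y1 * Y2), measurable C -> G ((fun x => (h x, k x)) @^-1` C).
Proof.
move=> Gh Gk C mC.
have := @smallest_sub _ (sigma_algebra setT) _ _
  (preimage_sigma_algebra (fun x => (h x, k x))) _ C mC.
apply => _ /= [[A mA <-]|[A mA <-]]; rewrite setTI; [exact: Gh|exact: Gk].
Qed.

End preimage_sigma.

Section characters.
Context (R : realType) (X : Type).
Local Notation T := (torus R).
Variable Ch : set (X -> T).
Hypothesis ChD : forall f g, Ch f -> Ch g -> Ch (fun x => f x + g x).
Hypothesis ChB : forall f g, Ch f -> Ch g -> Ch (fun x => f x - g x).

(** The free phase [t] includes sines and makes the set stable under products up to linear
    combinations, so real-valued functions suffice. *)
Definition trig_set : set (X -> R) :=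
  [set f | exists2 g, Ch g & exists t, f = fun x => tcos (g x + t)].

Lemma trig_set_bounded f : trig_set f -> exists M : R, forall x, `|f x| <= M.
Proof. by move=> [g _ [t ->]]; exists 1 => x; exact: tcos_max. Qed.

Lemma trig_set_mul f g : trig_set f -> trig_set g ->
  mclosure trig_set (fun x => f x * g x).
Proof.
move=> [u Cu [s ->]] [v Cv [t ->]].
pose f1 x := tcos ((u x + v x) + (s + t)).
pose f2 x := tcos ((u x - v x) + (s - t)).
have W1 : mclosure trig_set f1.
  by apply: mclosure_sub; exists (fun x => u x + v x); [exact: ChD|exists (s + t)].
have W2 : mclosure trig_set f2.
  by apply: mclosure_sub; exists (fun x => u x - v x); [exact: ChB|exists (s - t)].
have := mclosure_scale (2^-1) (mclosure_add W1 W2).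
congr (mclosure trig_set _); apply/funext => x.
have e1 : u x + v x + (s + t) = u x + s + (v x + t) by rewrite addrACA.
have e2 : u x - v x + (s - t) = u x + s - (v x + t) by rewrite opprD addrACA.
by rewrite tcosM /f1 /f2 e1 e2 mulrC.
Qed.

Lemma usin_sign (x : R) : 0 <= x < 1 -> (usin x < 0) = (2^-1 < x).
Proof.
move=> /andP[x0 x1]; case: (ltrgtP 2^-1 x) => xh.
- have : 0 < usin (1 - x) by apply: usin_gt0; lra.
  by rewrite usinB /usin mulr1 mulr_natl sin2pi -/(usin x) /ucos mulr1 mulr_natl cos2pi; lra.
- apply/negbTE; rewrite -leNgt; have [->|x0'] := eqVneq x 0.
    by rewrite /usin mulr0 sin0.
  by apply/ltW/usin_gt0; rewrite lt_neqAle eq_sym x0' x0.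
- by rewrite -xh /usin mulrAC divff // mul1r sinpi ltxx.
Qed.

(* The arc [(a, 1)] is the union or the intersection of two open half circles. *)
Lemma section_gt (s a : R) : 0 <= s < 1 -> 0 < a < 1 ->
  (a < s) = (if a < 2^-1 then (0 < usin (s - a)) || (usin s < 0)
             else (0 < usin (s - a)) && (usin s < 0)).
Proof.
move=> s01 /andP[a0 a1]; rewrite usin_sign //; have /andP[s0 s1] := s01.
have e1 : 0 < s - a < 2^-1 -> 0 < usin (s - a) by exact: usin_gt0.
have e2 : - 2^-1 < s - a < 0 -> usin (s - a) < 0.
  by move=> h; rewrite -[s - a]opprK usinN oppr_lt0; apply: usin_gt0; lra.
have e0 : s = a -> usin (s - a) = 0 by move=> ->; rewrite subrr /usin mulr0 sin0.
case: (ltP a 2^-1) => ah; case: (ltP 2^-1 s) => sh; rewrite ?orbT ?orbF ?andbT ?andbF.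
- lra.
- case: (ltrgtP a s) => as_.
  + by rewrite e1 //; lra.
  + by apply/esym/negbTE; rewrite -leNgt ltW // e2 //; lra.
  + by rewrite e0 // ltxx.
- case: (ltrgtP a s) => as_.
  + by rewrite e1 //; lra.
  + by apply/esym/negbTE; rewrite -leNgt ltW // e2 //; lra.
  + by rewrite e0 // ltxx.
- by apply/negbTE; rewrite -leNgt; lra.
Qed.

Let sG : sigma_algebra setT (mclosure_sets trig_set) :=
  mclosure_sigma_algebra trig_set_bounded trig_set_mul.

Lemma character_sets (c : X -> T) : Ch c ->
  forall A, measurable A -> mclosure_sets trig_set (c @^-1` A).
Proof.
move=> Cc.
have Wc t : mclosure trig_set (fun x => tcos (c x + t)).
  by apply: mclosure_sub; exists c => //; exists t.
have Ws a : mclosure trig_set (fun x => usin (torus_section (c x) - a)).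
  have := Wc (torus_pi (- (a + 4^-1))).
  congr (mclosure trig_set _); apply/funext => x.
  rewrite usinE -{1}(torus_sectionK (c x)) -torus_piD tcos_pi.
  by congr ucos; ring.
have ps a : mclosure_sets trig_set [set x | 0 < usin (torus_section (c x) - a)].
  apply: mclosure_pos => //; [exact: trig_set_bounded|exact: trig_set_mul|].
  by move=> x; exact: usin_max.
have ns : mclosure_sets trig_set [set x | usin (torus_section (c x)) < 0].
  rewrite (_ : [set x | _] = [set x | 0 < -1 * usin (torus_section (c x) - 0)]).
    apply: mclosure_pos => //; [exact: trig_set_bounded|exact: trig_set_mul| |].
      exact: mclosure_scale.
    by move=> x; rewrite mulN1r normrN usin_max.
  by apply/seteqP; split => x /=; rewrite subr0 mulN1r oppr_gt0.
have ray (a : R) : mclosure_sets trig_set [set x | a < torus_section (c x)].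
  case: (ltP a 0) => a0.
    rewrite (_ : [set x | _] = setT).
      by rewrite -setC0; apply: mclosure_setC; have [] := sG.
    apply/seteqP; split => x //= _.
    by have /andP[s0 _] := torus_section_itv (c x); exact: lt_le_trans s0.
  case: (ltP a 1) => a1; last first.
    rewrite (_ : [set x | _] = set0); first by have [] := sG.
    apply/seteqP; split => x //=; have /andP[_ s1] := torus_section_itv (c x).
    by move=> h; move: (lt_trans (le_lt_trans a1 h) s1); rewrite ltxx.
  have [a0'|a0'] := eqVneq a 0; last first.
    have a01 : 0 < a < 1 by rewrite a1 lt_neqAle eq_sym a0' a0.
    rewrite (_ : [set x | _] = if a < 2^-1 then
      [set x | 0 < usin (torus_section (c x) - a)] `|`
        [set x | usin (torus_section (c x)) < 0]
      else [set x | 0 < usin (torus_section (c x) - a)] `&`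
        [set x | usin (torus_section (c x)) < 0]).
      case: ifP => _; [apply: mclosure_setU|apply: mclosure_setI] => //;
        by [exact: trig_set_bounded|exact: trig_set_mul].
    apply/seteqP; split => x /=; rewrite (section_gt (torus_section_itv _) a01);
      by case: ifP => _ /=; [move/orP|move/andP].
  (* The circle without the point 0 is the set where 1 - cos is positive; the factor one half keeps
     the function within the bound 1 that [mclosure_pos] asks for. *)
  rewrite a0' (_ : [set x | _] = [set x | 0 < 2^-1 - 2^-1 * tcos (c x + 0)]).
    have := mclosure_add (mclosure_cst (B := trig_set) 2^-1) (mclosure_scale (- 2^-1) (Wc 0)).
    rewrite (_ : (fun x => _) = (fun x => 2^-1 - 2^-1 * tcos (c x + 0))); last first.
      by apply/funext => x; rewrite mulNr.
    move=> W; apply: mclosure_pos => //; [exact: trig_set_bounded|exact: trig_set_mul|].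
    by move=> x; have := tcos_max (c x + 0); rewrite !ler_norml; lra.
  apply/seteqP; split => x /=; rewrite addr0 /tcos;
    move: (torus_section _) (torus_section_itv (c x)) => s /andP[s0 s1].
    move=> s0'; have : 0 < usin (s / 2) by apply: usin_gt0; lra.
    rewrite (_ : s = s / 2 + s / 2); last by field.
    rewrite ucosD; have := ucos2Dusin2 (s / 2).
    by rewrite -!splitr; nra.
  move=> h; rewrite lt_neqAle s0 andbT; apply/eqP => s0'.
  by move: h; rewrite -s0' ucos0 mulr1 subrr ltxx.
move=> A mA.
have mB : measurable ((@torus_pi R) @^-1` A).
  by rewrite -[X in measurable X]setTI; exact: measurable_torus_pi.
rewrite (_ : c @^-1` A = (fun x => torus_section (c x)) @^-1` ((@torus_pi R) @^-1` A)); last first.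
  by apply/seteqP; split => x /=; rewrite torus_sectionK.
move: mB; rewrite RGenOInfty.measurableE => mB.
have := @smallest_sub _ (sigma_algebra setT) _ _
  (preimage_sigma_algebra sG (fun x => torus_section (c x))) _ _ mB.
apply => _ /= [a ->]; have := ray a; congr (mclosure_sets _ _).
by apply/seteqP; split => x /=; rewrite in_itv /= andbT.
Qed.

End characters.

Section ergodic_characters.
Context (R : realType) d (X : measurableType d) (mu : probability X R).
Variable Ch : set (X -> torus R).
Hypothesis Chgen : measurable `<=` mclosure_sets (trig_set Ch).
Variable S : int -> X -> X.
Hypothesis mpS : forall n, measure_preserving mu (S n).

Lemma ergodic_characters :
  (forall Phi, folner R Phi -> forall g t, Ch g ->
     mean_cvg mu S Phi (fun x => tcos (g x + t))) ->
  ergodic mu S.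
Proof.
move=> H; apply: ergodic_criterion => // Phi fPhi f [mf [M fM]].
have := mclosure_bounded_measurable Chgen mf fM.
apply; first exact: mean_cvg_class.
by move=> _ [g Cg [t ->]]; exact: H.
Qed.

End ergodic_characters.

(** * The transformations *)

(** Gathers each side of an equation on the circle into the image of one real number, where [ring]
    decides it; the rewrites are repeated to reach nested terms. *)
Ltac torus_ring :=
  rewrite -?torus_piMz -?torus_piN -?torus_piD -?torus_piMz -?torus_piN -?torus_piD;
  rewrite -?torus_piMz -?torus_piN -?torus_piD -?torus_piMz -?torus_piN -?torus_piD;
  congr (torus_pi _); rewrite ?(intrD, intrM, mulrNz); ring.

Section skew_bijections.
Variable R : realType.
Local Notation T := (torus R).
Implicit Types (a b c : T) (k n : int).

Lemma skew_comp a k b a' k' b' (z : torus2 R) :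
  skew a k b (skew a' k' b' z) = skew (a' + a) (k' + k) (b' + a' *~ k + b) z.
Proof.
case: z => x y; rewrite /skew /=.
have [{}x ->] := torus_pi_surj x; have [{}y ->] := torus_pi_surj y.
have [{}a ->] := torus_pi_surj a; have [{}b ->] := torus_pi_surj b.
have [{}a' ->] := torus_pi_surj a'; have [{}b' ->] := torus_pi_surj b'.
by congr (_, _); torus_ring.
Qed.

Lemma skew0 (z : torus2 R) : skew 0 0 0 z = z.
Proof. by case: z => x y; rewrite /skew /= mulr0z !addr0. Qed.

Lemma skewK a k b : cancel (skew a k b) (skew (- a) (- k) (a *~ k - b)).
Proof.
move=> z; rewrite skew_comp !subrr mulrNz (_ : _ + (_ - b) = 0) ?skew0 //.
have [{}a ->] := torus_pi_surj a; have [{}b ->] := torus_pi_surj b.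
by rewrite -torus_pi0; torus_ring.
Qed.

Lemma skewVK a k b : cancel (skew (- a) (- k) (a *~ k - b)) (skew a k b).
Proof.
move=> z; rewrite skew_comp !addNr (_ : _ + b = 0) ?skew0 //.
have [{}a ->] := torus_pi_surj a; have [{}b ->] := torus_pi_surj b.
by rewrite -torus_pi0; torus_ring.
Qed.

Definition bskew a k b : bijection (torus2 R) := Bijection (skewK a k b) (skewVK a k b).

Lemma bskewM a k b a' k' b' :
  (bskew a k b * bskew a' k' b')%g = bskew (a' + a) (k' + k) (b' + a' *~ k + b).
Proof. by apply: bijectionP => z; rewrite /= skew_comp. Qed.

Lemma bskew1 : bskew 0 0 0 = 1%g.
Proof. by apply: bijectionP => z; rewrite /= skew0. Qed.

(** With shear 2 and the extra summand [a], the iterates contain n (n - 1) a + n a = n^2 a, so no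
    halves occur. *)
Definition two_step a c := bskew a 2 (a + c).

(** The right-hand side is a homomorphism in [n] whose value at 1 is the map itself; negative powers
    follow by cancellation. *)
Lemma zpow_two_step a c n :
  zpow (two_step a c) n = bskew (a *~ n) (2 * n) (a *~ (n ^+ 2) + c *~ n).
Proof.
pose P n := bskew (a *~ n) (2 * n) (a *~ (n ^+ 2) + c *~ n).
have PD m n' : (P m * P n')%g = P (m + n').
  rewrite /P bskewM; have [x ->] := torus_pi_surj a; have [y ->] := torus_pi_surj c.
  congr (bskew _ _ _); [torus_ring|ring|].
  by rewrite !expr2; torus_ring.
have P0 : P 0 = 1%g by rewrite /P mulr0 expr0n !mulr0z addr0 bskew1.
have Pn (m : nat) : (two_step a c ^+ m)%g = P m.
  elim: m => [|m IH]; first by rewrite P0.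
  by rewrite expgS IH [LHS](PD 1) -intS.
case: n => m; first by rewrite /= Pn.
by rewrite /zpow Pn; apply: (mulgI (P m.+1)); rewrite mulgV PD NegzE subrr P0.
Qed.

End skew_bijections.

(** * Linear independence of 1, sqrt 2 and sqrt 3 *)

Section irrationality.
Variable R : realType.

(** Unless [a] vanishes, the valuation at [p] is odd on the left and even on the right. *)
Lemma logn_odd_nonsquare (p N : nat) (a b : int) : prime p -> odd (logn p N) ->
  N%:Z * a ^+ 2 = b ^+ 2 -> a = 0.
Proof.
move=> pp oN e; apply/eqP; apply: contraT => a0.
have N0 : (0 < N)%N by case: N oN e => //; rewrite logn0.
have e' : (N * `|a| ^ 2 = `|b| ^ 2)%N.
  by have := congr1 absz e; rewrite abszM !abszX.
have a0' : (0 < `|a|)%N by rewrite absz_gt0.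
have := congr1 (odd \o logn p) e' => /=.
by rewrite lognM ?expn_gt0 ?a0' // !lognX oddD oN !oddM /=.
Qed.

Lemma sqrt23_indep (a b c : int) :
  a%:~R * Num.sqrt 2 + b%:~R * Num.sqrt 3 = c%:~R :> R -> a = 0 /\ b = 0.
Proof.
set s := Num.sqrt 2; set t := Num.sqrt 3 => e.
have s2 : s ^+ 2 = 2 by rewrite sqr_sqrtr.
have t2 : t ^+ 2 = 3 by rewrite sqr_sqrtr.
have H (m n : int) (N : nat) (r : R) : r ^+ 2 = N%:R -> m%:~R * r = n%:~R ->
    N%:Z * m ^+ 2 = n ^+ 2.
  move=> r2 mr; apply: (@intr_inj R); rewrite !expr2 !intrM -mr -pmulrn -r2; ring.
have I2 (m n : int) : m%:~R * s = n%:~R -> m = 0.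
  by move=> /(H _ _ 2%N _ s2); apply: (@logn_odd_nonsquare 2).
have I3 (m n : int) : m%:~R * t = n%:~R -> m = 0.
  by move=> /(H _ _ 3%N _ t2); apply: (@logn_odd_nonsquare 3).
have I6 (m n : int) : m%:~R * (s * t) = n%:~R -> m = 0.
  have st2 : (s * t) ^+ 2 = 6%:R by rewrite exprMn s2 t2; ring.
  by move=> /(H _ _ 6%N _ st2); apply: (@logn_odd_nonsquare 2).
(* Squaring the relation isolates 2 a b sqrt 6 as an integer, and sqrt 6 is irrational. *)
have ab : 2 * a * b = 0.
  apply: (I6 _ (c ^+ 2 - 2 * a ^+ 2 - 3 * b ^+ 2)).
  transitivity ((a%:~R * s + b%:~R * t) ^+ 2 - a%:~R ^+ 2 * s ^+ 2 - b%:~R ^+ 2 * t ^+ 2).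
    by ring.
  by rewrite s2 t2 e; ring.
move/eqP: ab; rewrite -mulrA !mulf_eq0 /= => /orP[]/eqP h0; move: e; rewrite h0.
  by rewrite mul0r add0r => /I3 ->.
by rewrite mul0r addr0 => /I2 ->.
Qed.

End irrationality.

(** * The polynomials and their phases *)

Section polynomials.

Definition pol (i : 'I_4) : {poly int} :=
  nth 0 [:: 'X; 'X^3; 'X^3 + 'X^2 - 'X; 'X^3 - 'X^2] i.

Lemma ord4P (P : 'I_4 -> Prop) : P 0 -> P 1 -> P 2 -> P 3 -> forall i, P i.
Proof.
move=> P0 P1 P2 P3; case=> [[|[|[|[|//]]]] h].
- by rewrite (_ : Ordinal h = 0) //; apply: val_inj.
- by rewrite (_ : Ordinal h = 1) //; apply: val_inj.
- by rewrite (_ : Ordinal h = 2) //; apply: val_inj.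
- by rewrite (_ : Ordinal h = 3) //; apply: val_inj.
Qed.

Lemma sum4 (V : nmodType) (F : 'I_4 -> V) :
  \sum_i F i = F 0 + F 1 + F 2 + F 3.
Proof.
rewrite !big_ord_recl big_ord0 addr0 !addrA.
by congr (_ + F _ + F _ + F _); apply: val_inj.
Qed.

Lemma pol_horner (n : int) : ((pol 0).[n] = n) * ((pol 1).[n] = n ^+ 3) *
  ((pol 2).[n] = n ^+ 3 + n ^+ 2 - n) * ((pol 3).[n] = n ^+ 3 - n ^+ 2).
Proof. by rewrite /pol /= !hornerE. Qed.

Lemma size_coef_gt1 (p : {poly int}) k : (0 < k)%N -> p`_k != 0 -> (1 < size p)%N.
Proof.
move=> k0; apply: contraNltn => sp; rewrite nth_default //.
exact: leq_trans sp k0.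
Qed.

Lemma size_pol_gt1 i : (1 < size (pol i))%N.
Proof.
by elim/ord4P: i; [apply: (@size_coef_gt1 _ 1)|apply: (@size_coef_gt1 _ 3)..];
  rewrite // /pol /= !coefE.
Qed.

Lemma size_polB_gt1 (i j : 'I_4) : (i < j)%N -> (1 < size (pol i - pol j)%R)%N.
Proof.
by elim/ord4P: i; elim/ord4P: j => //= _;
  first [by apply: (@size_coef_gt1 _ 3); rewrite // /pol /= !coefE |
         by apply: (@size_coef_gt1 _ 2); rewrite // /pol /= !coefE].
Qed.

(** The indices counted are distinct roots of [p - c], which has the size of [p] because [p] is not
    constant. *)
Lemma poly_fiber (p : {poly int}) (n : int) (A : {fset int}) : (1 < size p)%N ->
  (count (fun m => p.[n] == p.[m]) (enum_fset A) <= size p)%N.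
Proof.
move=> sp; rewrite -size_filter.
set c := (p.[n])%:P.
have sc : (size (- c) < size p)%N by rewrite size_polyN (leq_ltn_trans (size_polyC_leq1 _)).
have spc : size (p - c) = size p by rewrite size_polyDl.
rewrite -spc; apply: ltnW; apply: max_poly_roots.
- by rewrite -size_poly_gt0 spc ltnW.
- apply/allP => m; rewrite mem_filter => /andP[/eqP e _].
  by rewrite /root !hornerE e subrr.
- by rewrite filter_uniq // fset_uniq.
Qed.

End polynomials.

Section phases.
Variable R : realType.

(** The default value of [nth] supplies sqrt 2 at the indices 1, 2 and 3. *)
Definition rotation (i : 'I_4) : R := nth (Num.sqrt 2) [:: 2 * Num.sqrt 3] i.
Definition drift (i : 'I_4) : R := nth 0 [:: 0; Num.sqrt 3; 0; 2 * Num.sqrt 3] i.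

Lemma irr_sqrt2 (m : int) : m != 0 -> irr (m%:~R * Num.sqrt 2 : R).
Proof.
move=> m0 k k0; apply/negP => /intrP[c e].
have [] := @sqrt23_indep R (k * m) 0 c.
  by rewrite -e intrM; ring.
by move/eqP; rewrite mulf_eq0 (negPf m0) (negPf k0).
Qed.

Lemma weyl_phase (Phi : nat -> {fset int}) (a : 'I_4 -> int) (c : R) :
  folner R Phi -> (exists i, a i != 0) ->
  favg (Phi N) (fun n => ucos (\sum_i (a i)%:~R * ((pol i).[n]%:~R * rotation i) + c))
    @[N --> \oo] --> (0 : R).
Proof.
move=> fPhi a0.
set s : R := Num.sqrt 2; set t : R := Num.sqrt 3.
pose A := a 1 + a 2 + a 3; pose B := a 2 - a 3.
pose C : R := (2 * a 0)%:~R * t - (a 2)%:~R * s.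
have E (n : int) : \sum_i (a i)%:~R * ((pol i).[n]%:~R * rotation i) + c =
    (A%:~R * s) * n%:~R ^+ 3 + (B%:~R * s) * n%:~R ^+ 2 + C * n%:~R + c.
  by rewrite sum4 !pol_horner /rotation /A /B /C /= -/s -/t; ring.
under [X in X @ _ --> _]eq_fun do under eq_fun do rewrite E.
have [A0|A0] := eqVneq A 0; last exact: (weyl3 fPhi _ _ _ (irr_sqrt2 A0)).
have [B0|B0] := eqVneq B 0; last first.
  have := weyl2 fPhi C c (irr_sqrt2 B0); apply: eq_cvgn => N; congr favg.
  by apply/funext => n; rewrite A0 !mul0r add0r.
(* An integral slope would give [a 0 = a 2 = 0] by independence of the square roots; then [B = 0]
   and [A = 0] give [a 3 = 0] and [a 1 = 0], against [a0]. *)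
have CZ : C \isn't a Num.int.
  apply/negP => /intrP[m e].
  have [h0 h2] : - a 2 = 0 /\ 2 * a 0 = 0.
    by apply: (@sqrt23_indep R _ _ m); rewrite -e /C -/s -/t; ring.
  have h : a 0 = 0 /\ a 2 = 0 by split; lia.
  have hk : a 3 = 0 /\ a 1 = 0 by rewrite /A /B in A0 B0; split; lia.
  case: a0 => i; elim/ord4P: i; rewrite ?h.1 ?h.2 ?hk.1 ?hk.2 eqxx //.
have := weyl1 fPhi c CZ; apply: eq_cvgn => N; congr favg.
by apply/funext => n; rewrite A0 B0 !mul0r !add0r.
Qed.

End phases.

(** * Ergodicity *)

Section skew_dynamics.
Variable R : realType.
Local Notation T := (torus R).

Definition nilrotation (i : 'I_4) : bijection (torus2 R) :=
  two_step (torus_pi (rotation R i)) (torus_pi (drift R i)).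

Definition character2 (a b : int) (w : torus2 R) : T := w.1 *~ a + w.2 *~ b.

Lemma measurable_character2 a b : measurable_fun setT (character2 a b).
Proof. by apply: measurable_torus_add; exact: measurable_torus_mulz. Qed.

(** Translating the starting point by [(s, u)] only adds a constant phase. Its dependence on the
    shear [q] comes through [b], so characters that involve y can be told apart at different
    times. *)
Lemma character2_shift a b (s u : T) (q : int) (v1 v2 : T) w :
  character2 a b (skew v1 q v2 (skew s 0 u w)) =
  character2 a b (skew v1 q v2 w) + (s *~ (a + b * q) + u *~ b).
Proof.
case: w => x y; rewrite /character2 /skew /=.
have [{}x ->] := torus_pi_surj x; have [{}y ->] := torus_pi_surj y.
have [{}s ->] := torus_pi_surj s; have [{}u ->] := torus_pi_surj u.
have [{}v1 ->] := torus_pi_surj v1; have [{}v2 ->] := torus_pi_surj v2.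
torus_ring.
Qed.

Lemma character2_addr_skew0 a (v1 v2 : T) (q : int) w :
  character2 a 0 (skew v1 q v2 w) = w.1 *~ a + v1 *~ a.
Proof. by rewrite /character2 /= mulr0z addr0 mulrzDl. Qed.

Section orthogonal.
Context d (X : measurableType d) (mu : probability X R).
Variables (g : int -> X -> T) (q : {poly int}) (a b : int).
Hypothesis mg : forall n, measurable_fun setT (g n).
Hypothesis q1 : (1 < size q)%N.
Hypothesis b0 : b != 0.
Hypothesis shift_g : forall s u : T, exists2 tau, measure_preserving mu tau &
  forall n z, g n (tau z) = g n z + (s *~ (a + b * (2 * q.[n])) + u *~ b).

(** The product of two cosines splits into the sum and the difference of the phases. A vertical
    translation [u] with 2 b u = 1/2 kills the first; on the second it has no effect, and a
    horizontal one with 2 b (q(n) - q(m)) s = 1/2 is used, available when the two values of [q]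
    differ. *)
Lemma skew_orthogonal (A : {fset int}) : A != fset0 ->
  mean mu (fun z => favg A (fun n => tcos (g n z)) ^+ 2) <= (size q)%:R / #|` A|%:R.
Proof.
move=> A0; apply: (mean_sqr_favg_tcos (bad := fun n m => q.[n] == q.[m])) => //.
  by move=> n B; exact: poly_fiber.
move=> n m nm.
have bp : bounded_measurable (fun x => tcos (g n x + g m x)).
  by apply: bounded_measurable_tcos; exact: measurable_torus_add.
have bq : bounded_measurable (fun x => tcos (g n x - g m x)).
  apply: bounded_measurable_tcos; apply: measurable_torus_add => //.
  exact: measurable_torus_opp.
have -> : (fun x => tcos (g n x) * tcos (g m x)) =
    (fun x => 2^-1 * (tcos (g n x + g m x) + tcos (g n x - g m x))).
  by apply/funext => x; rewrite tcosM mulrC.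
rewrite meanZ; last exact: bounded_measurableD.
rewrite meanD //.
have b2 : 2 * b != 0 by rewrite mulf_neq0.
have [u uE] := @torus_div R (torus_pi 2^-1) (2 * b) b2.
have [t1 mt1 t1E] := shift_g 0 u.
rewrite (mean_tcos0 _ mt1) ?add0r; last 2 first.
- exact: measurable_torus_add.
- move=> x; rewrite !t1E !mul0rz !add0r addrACA; congr (_ + _).
  by rewrite -uE -mulrzDr; congr (_ *~ _); ring.
have qnm : 2 * b * (q.[n] - q.[m]) != 0 by rewrite !mulf_neq0 // subr_eq0.
have [s sE] := @torus_div R (torus_pi 2^-1) _ qnm.
have [t2 mt2 t2E] := shift_g s 0.
rewrite (mean_tcos0 _ mt2) ?mulr0 //.
- by apply: measurable_torus_add => //; exact: measurable_torus_opp.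
- move=> x; rewrite !t2E !mul0rz !addr0 opprD addrACA -sE; congr (_ + _).
  by rewrite -mulrzBr; congr (_ *~ _); ring.
Qed.

End orthogonal.

Lemma favg_tcos_phase (Phi : nat -> {fset int}) (a : 'I_4 -> int) (t : T) :
  folner R Phi -> (exists i, a i != 0) ->
  favg (Phi N) (fun n =>
      tcos (\sum_i (torus_pi (rotation R i) *~ (pol i).[n]) *~ a i + t))
    @[N --> \oo] --> (0 : R).
Proof.
move=> fPhi a0; have := weyl_phase (torus_section t) fPhi a0.
apply: eq_cvgn => N; congr favg; apply/funext => n.
rewrite -tcos_pi torus_piD torus_sectionK; congr (tcos (_ + _)).
rewrite (big_morph _ (@torus_piD R) (@torus_pi0 R)); apply: eq_bigr => i _.
by rewrite -torus_piMz -torus_piMz.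
Qed.

End skew_dynamics.

Section ergodic_systems.
Variable R : realType.
Local Notation T := (torus R).
Local Notation X4 := (torus2 R * torus2 R * torus2 R * torus2 R)%type.

Definition characters2 : set (torus2 R -> T) :=
  [set f | exists a b, f = character2 a b].

Lemma character2D (a b a' b' : int) (w : torus2 R) :
  character2 a b w + character2 a' b' w = character2 (a + a') (b + b') w.
Proof.
case: w => x y; rewrite /character2 /=.
have [{}x ->] := torus_pi_surj x; have [{}y ->] := torus_pi_surj y.
torus_ring.
Qed.

Lemma character2B (a b a' b' : int) (w : torus2 R) :
  character2 a b w - character2 a' b' w = character2 (a - a') (b - b') w.
Proof.
case: w => x y; rewrite /character2 /=.
have [{}x ->] := torus_pi_surj x; have [{}y ->] := torus_pi_surj y.
torus_ring.
Qed.

Lemma characters2_generate : measurable `<=` mclosure_sets (trig_set characters2).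
Proof.
have CD f g : characters2 f -> characters2 g -> characters2 (fun x => f x + g x).
  move=> [a [b ->]] [a' [b' ->]]; exists (a + a'), (b + b').
  by apply/funext => w; rewrite character2D.
have CB f g : characters2 f -> characters2 g -> characters2 (fun x => f x - g x).
  move=> [a [b ->]] [a' [b' ->]]; exists (a - a'), (b - b').
  by apply/funext => w; rewrite character2B.
have sG := mclosure_sigma_algebra (@trig_set_bounded _ _ characters2) (trig_set_mul CD CB).
move=> A mA; have := preimage_pair_sigma_algebra sG _ _ mA (h := fst) (k := snd).
rewrite (_ : (fun x => (x.1, x.2)) @^-1` A = A); last by apply/seteqP; split => -[].
apply => B mB; apply: (character_sets CD CB) => //.
  by exists 1, 0; apply/funext => w; rewrite /character2 mulr1z mulr0z addr0.
by exists 0, 1; apply/funext => w; rewrite /character2 mulr1z mulr0z add0r.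
Qed.

Lemma ergodic_skew (q : {poly int}) (v1 v2 : int -> T) : (1 < size q)%N ->
  (forall Phi a t, folner R Phi -> a != 0 ->
    favg (Phi N) (fun n => tcos (v1 n *~ a + t)) @[N --> \oo] --> (0 : R)) ->
  ergodic (haar2 R) (fun n => skew (v1 n) (2 * q.[n]) (v2 n)).
Proof.
move=> q1 H.
have mp n : measure_preserving (haar2 R) (skew (v1 n) (2 * q.[n]) (v2 n)).
  exact: measure_preserving_skew_torus.
apply: (@ergodic_characters _ _ _ _ characters2) => //.
  exact: characters2_generate.
move=> Phi fPhi _ t [a [b ->]].
have mc : measurable_fun setT (fun w => character2 a b w + t).
  by apply: measurable_torus_add => //; exact: measurable_character2.
have bc := bounded_measurable_tcos mc.
have [b0|b0] := eqVneq b 0; last first.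
  apply: (mean_cvg_orthogonal mp fPhi (D := (size q)%:R)) => // N.
  apply: (@skew_orthogonal _ _ _ (haar2 R)
    (fun n z => character2 a b (skew (v1 n) (2 * q.[n]) (v2 n) z) + t) q a b) => //;
    last exact: fPhi.1.
    by move=> n; apply: measurableT_comp mc _; exact: (mp n).1.
  move=> s u; exists (skew s 0 u); first exact: measure_preserving_skew_torus.
  by move=> n z; rewrite character2_shift addrAC.
have [a0|a0] := eqVneq a 0.
  (* The trivial character: the constant is reached from the constant 1 as (tcos t - 1) 1 + 1. *)
  rewrite (_ : (fun x => _) = (fun=> tcos t)).
    have := mc_lin (mean_cvg_class mp fPhi) (tcos t - 1)
      (mc_cst1 (mean_cvg_class mp fPhi)) (mc_cst1 (mean_cvg_class mp fPhi)).
    by congr mean_cvg; apply/funext => x; ring.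
  by apply/funext => w; rewrite a0 b0 /character2 !mulr0z !add0r.
apply: mean_cvg_pointwise => // w.
have := H _ a (w.1 *~ a + t) fPhi a0; apply: eq_cvgn => N; congr favg; apply/funext => n.
by rewrite b0 character2_addr_skew0 addrA (addrC (_ *~ _)).
Qed.

Lemma ergodic_difference (i j : 'I_4) : (i < j)%N ->
  ergodic (haar2 R) (fun n =>
    (zpow (nilrotation R i) (pol i).[n] * zpow (nilrotation R j) (- (pol j).[n]))%g).
Proof.
move=> ij; set r := fun k => torus_pi (rotation R k).
set c := fun k => torus_pi (drift R k).
rewrite (_ : (fun n => _) = (fun n => skew (r j *~ (- (pol j).[n]) + r i *~ (pol i).[n])
   (2 * (pol i - pol j).[n])
   ((r j *~ (- (pol j).[n]) ^+ 2 + c j *~ (- (pol j).[n]))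
    + (r j *~ (- (pol j).[n])) *~ (2 * (pol i).[n])
    + (r i *~ (pol i).[n] ^+ 2 + c i *~ (pol i).[n])))); last first.
  apply/funext => n; rewrite !zpow_two_step bskewM /=; congr skew.
  by rewrite hornerD hornerN; ring.
apply: ergodic_skew; first exact: size_polB_gt1.
move=> Phi a t fPhi a0.
have ji : j != i by rewrite eq_sym neq_ltn ij.
(* In the base, the pair rotates by p_i(n) a_i - p_j(n) a_j, which is the phase with coefficient [a]
   at [i] and [- a] at [j]. *)
pose e k : int := if k == i then a else if k == j then - a else 0.
have e0 : exists k, e k != 0 by exists i; rewrite /e eqxx.
have := favg_tcos_phase t fPhi e0; apply: eq_cvgn => N; congr favg; apply/funext => n.
rewrite (bigD1 i) //= (bigD1 j) //= big1 => [|k /andP[/negPf ki /negPf kj]]; last first.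
  by rewrite /e ki kj mulr0z.
rewrite /e eqxx (negPf ji) eqxx addr0; congr (tcos (_ + _)).
by rewrite [RHS]mulrzDl [RHS]addrC !mulrNz mulNrz.
Qed.

Definition coord4 (i : 'I_4) (z : X4) : torus2 R :=
  nth z.2 [:: z.1.1.1; z.1.1.2; z.1.2] i.

Lemma coord4_prod4 (S : 'I_4 -> torus2 R -> torus2 R) i (z : X4) :
  coord4 i (prod4 S z) = S i (coord4 i z).
Proof. by elim/ord4P: i. Qed.

Lemma measurable_coord4 i : measurable_fun setT (coord4 i).
Proof.
elim/ord4P: i; rewrite /coord4 /=.
- apply: (measurableT_comp (f := fst)) => //; apply: (measurableT_comp (f := fst)) => //.
- apply: (measurableT_comp (f := snd)) => //; apply: (measurableT_comp (f := fst)) => //.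
- apply: (measurableT_comp (f := snd)) => //.
- exact: measurable_snd.
Qed.

Definition character8 (a b : 'I_4 -> int) (z : X4) : T :=
  \sum_i character2 (a i) (b i) (coord4 i z).

Definition characters8 : set (X4 -> T) := [set f | exists a b, f = character8 a b].

Lemma measurable_character8 a b : measurable_fun setT (character8 a b).
Proof.
rewrite (_ : character8 a b = fun z => character2 (a 0) (b 0) (coord4 0 z) +
   character2 (a 1) (b 1) (coord4 1 z) + character2 (a 2) (b 2) (coord4 2 z) +
   character2 (a 3) (b 3) (coord4 3 z)); last by apply/funext => z; exact: sum4.
have mc i : measurable_fun setT (fun z => character2 (a i) (b i) (coord4 i z)).
  exact: measurableT_comp (measurable_character2 _ _) (measurable_coord4 i).
by do 3 (apply: measurable_torus_add; last exact: mc).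
Qed.

Lemma characters8_generate : measurable `<=` mclosure_sets (trig_set characters8).
Proof.
have CD f g : characters8 f -> characters8 g -> characters8 (fun x => f x + g x).
  move=> [a [b ->]] [a' [b' ->]]; exists (fun i => a i + a' i), (fun i => b i + b' i).
  apply/funext => w; rewrite /character8 -big_split; apply: eq_bigr => i _.
  exact: character2D.
have CB f g : characters8 f -> characters8 g -> characters8 (fun x => f x - g x).
  move=> [a [b ->]] [a' [b' ->]]; exists (fun i => a i - a' i), (fun i => b i - b' i).
  apply/funext => w; rewrite /character8 -sumrB; apply: eq_bigr => i _.
  exact: character2B.
have sG := mclosure_sigma_algebra (@trig_set_bounded _ _ characters8) (trig_set_mul CD CB).
have coordC i a b : characters8 (fun z => character2 a b (coord4 i z)).
  exists (fun k => if k == i then a else 0), (fun k => if k == i then b else 0).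
  apply/funext => z; rewrite /character8 (bigD1 i) //= eqxx big1 ?addr0 // => k /negPf ->.
  by rewrite /character2 !mulr0z addr0.
have coordG i A : measurable A -> mclosure_sets (trig_set characters8) (coord4 i @^-1` A).
  move=> mA; have := preimage_pair_sigma_algebra sG _ _ mA
    (h := fun z => (coord4 i z).1) (k := fun z => (coord4 i z).2).
  rewrite (_ : (fun x => (_, _)) = coord4 i); last by apply/funext => z; case: (coord4 i z).
  apply => B mB; apply: (character_sets CD CB) => //.
    have := coordC i 1 0; congr characters8; apply/funext => z.
    by rewrite /character2 mulr1z mulr0z addr0.
  have := coordC i 0 1; congr characters8; apply/funext => z.
  by rewrite /character2 mulr1z mulr0z add0r.
move=> A mA.
have := preimage_pair_sigma_algebra sG _ (coordG 3) mA
  (h := fun z => (coord4 0 z, coord4 1 z, coord4 2 z)).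
rewrite (_ : (fun x => _) @^-1` A = A); last by apply/seteqP; split => -[[[]]].
apply => A3 mA3; apply: (preimage_pair_sigma_algebra sG _ (coordG 2) mA3
  (h := fun z => (coord4 0 z, coord4 1 z))).
by move=> A2 mA2; exact: (preimage_pair_sigma_algebra sG (coordG 0) (coordG 1) mA2).
Qed.

Lemma ergodic_product :
  ergodic (haar2 R \x haar2 R \x haar2 R \x haar2 R)%E
    (fun n => prod4 (fun i => zpow (nilrotation R i) (pol i).[n])).
Proof.
set mu := (_ \x _)%E.
pose r i := torus_pi (rotation R i); pose c i := torus_pi (drift R i).
pose S i n := skew (r i *~ (pol i).[n]) (2 * (pol i).[n])
    (r i *~ (pol i).[n] ^+ 2 + c i *~ (pol i).[n]).
rewrite (_ : (fun n => _) = (fun n => prod4 (fun i => S i n))); last first.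
  by apply/funext => n; congr prod4; apply/funext => i; rewrite zpow_two_step.
have mp n : measure_preserving mu (prod4 (fun i => S i n)).
  by apply: measure_preserving_prod4 => i; exact: measure_preserving_skew_torus.
apply: (@ergodic_characters _ _ _ mu characters8) => //.
  exact: characters8_generate.
move=> Phi fPhi _ t [a [b ->]].
have mc : measurable_fun setT (fun w => character8 a b w + t).
  by apply: measurable_torus_add => //; exact: measurable_character8.
have bc := bounded_measurable_tcos mc.
have [i bi|b0] := pickP (fun i => b i != 0).
  apply: (mean_cvg_orthogonal mp fPhi (D := (size (pol i))%:R)) => // N.
  apply: (@skew_orthogonal _ _ _ mu
    (fun n z => character8 a b (prod4 (fun i => S i n) z) + t)
    (pol i) (a i) (b i)) => //.
  - by move=> n; apply: measurableT_comp mc _; exact: (mp n).1.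
  - exact: size_pol_gt1.
  (* Only the factor whose character involves y is translated; the other factors contribute the same
     phase before and after. *)
  - move=> s u; exists (prod4 (fun j => if j == i then skew s 0 u else id)).
      apply: measure_preserving_prod4 => j; case: ifP => _.
        exact: measure_preserving_skew_torus.
      exact: measure_preserving_id.
    move=> n z; rewrite addrAC; congr (_ + _).
    rewrite /character8 (bigD1 i) // [in RHS](bigD1 i) //= !coord4_prod4 eqxx.
    rewrite character2_shift addrAC; congr (_ + _ + _).
    by apply: eq_bigr => j /negPf ji; rewrite !coord4_prod4 ji.
  - exact: fPhi.1.
have bE i : b i = 0 by apply/eqP; have := b0 i => /negbT; rewrite negbK.
have [i ai|a0] := pickP (fun i => a i != 0); last first.
  have aE i : a i = 0 by apply/eqP; have := a0 i => /negbT; rewrite negbK.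
  rewrite (_ : (fun x => _) = (fun=> tcos t)).
    have := mc_lin (mean_cvg_class mp fPhi) (tcos t - 1)
      (mc_cst1 (mean_cvg_class mp fPhi)) (mc_cst1 (mean_cvg_class mp fPhi)).
    by congr mean_cvg; apply/funext => x; ring.
  apply/funext => w; rewrite /character8 big1 ?add0r // => i _.
  by rewrite aE bE /character2 !mulr0z add0r.
apply: mean_cvg_pointwise => // w.
have := favg_tcos_phase (\sum_i (coord4 i w).1 *~ a i + t) fPhi (ex_intro _ i ai).
apply: eq_cvgn => N; congr favg; apply/funext => n.
rewrite addrA -big_split /character8; congr (tcos (_ + _)).
by apply: eq_bigr => k _; rewrite coord4_prod4 bE character2_addr_skew0 addrC.
Qed.

End ergodic_systems.

(** * Failure of joint ergodicity *)

Section torus_exponential.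
Variable R : realType.
Local Notation T := (torus R).

Definition tsin (z : T) : R := tcos (z - torus_pi 4^-1).

Definition texp (z : T) : R[i] := (tcos z +i* tsin z)%C.

Lemma tsin_pi (x : R) : tsin (torus_pi x) = usin x.
Proof. by rewrite /tsin -torus_piB tcos_pi usinE. Qed.

Lemma texpD (z w : T) : texp (z + w) = texp z * texp w.
Proof.
have [x ->] := torus_pi_surj z; have [y ->] := torus_pi_surj w.
rewrite /texp -torus_piD !tcos_pi !tsin_pi ucosD usinD.
by apply/eqP; rewrite eq_complex /= eqxx /= addrC.
Qed.

Lemma texp0 : texp 0 = 1.
Proof. by rewrite /texp -torus_pi0 tcos_pi tsin_pi ucos0 /usin mulr0 sin0. Qed.

Lemma normc_texp (z : T) : ComplexField.Normc.normc (texp z) = 1.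
Proof.
have [x ->] := torus_pi_surj z.
by rewrite /texp /= tcos_pi tsin_pi ucos2Dusin2 sqrtr1.
Qed.

Lemma bounded_measurable_Lfun_oo d (X : measurableType d) (mu : probability X R)
  (f : X -> R) : bounded_measurable f -> f \in Lfun mu +oo%E.
Proof.
move=> [mf [M fM]]; rewrite inE; apply/andP; split; rewrite inE //=.
rewrite /finite_norm unlock /Lnorm /=.
have -> : mu setT = 1%E := probability_setT mu.
rewrite lte01; apply: (@le_lt_trans _ _ M%:E); last exact: ltry.
by apply/ess_sup_inf.ess_supP; apply: nearW => x /=; rewrite lee_fin.
Qed.

Section texp_integrals.
Context d (X : measurableType d) (mu : probability X R) (g : X -> T).
Hypothesis mg : measurable_fun setT g.

Let mg4 : measurable_fun setT (fun x => g x - torus_pi 4^-1).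
Proof. exact: measurable_torus_add. Qed.

Lemma Linfty_texp : Linfty mu (fun x => texp (g x)).
Proof.
by split; apply: bounded_measurable_Lfun_oo; exact: bounded_measurable_tcos.
Qed.

Lemma cintegral_texp0 (tau : X -> X) : measure_preserving mu tau ->
  (forall x, g (tau x) = g x + torus_pi 2^-1) ->
  cintegral mu (fun x => texp (g x)) = 0.
Proof.
move=> mt gt; have e1 := mean_tcos0 mg mt gt.
have e2 : mean mu (fun x => tsin (g x)) = 0.
  by apply: (mean_tcos0 mg4 mt) => x; rewrite gt addrAC.
by apply/eqP; rewrite eq_complex; apply/andP; split; apply/eqP.
Qed.

End texp_integrals.

Definition witness_x (i : 'I_4) : int := nth 0 [:: 0; 1; 0; 1] i.
Definition witness_y (i : 'I_4) : int := nth 0 [:: 1; -2; 1; 1] i.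

(** The terms in [n x] cancel by the linear relation. With sqrt 2 the squares leave n^2 - 2 n^3,
    which [witness_x] cancels by p_2 + p_4 = 2 n^3 - n^2. With sqrt 3 the first square leaves 2 n^2,
    and the drifts give - 2 n^3 + 2 (n^3 - n^2). *)
Lemma witness_resonance (n : int) (z : torus2 R) :
  \sum_i character2 (witness_x i) (witness_y i)
    (zpow (nilrotation R i) (pol i).[n] z) = character2 2 1 z.
Proof.
case: z => x y; under eq_bigr do rewrite zpow_two_step.
rewrite sum4 /character2 !pol_horner /rotation /drift /witness_x /witness_y /= /skew /=.
have [{}x ->] := torus_pi_surj x; have [{}y ->] := torus_pi_surj y.
rewrite !expr2 !exprS !expr0.
torus_ring.
Qed.

Lemma not_jointly_ergodic : ~ jointly_ergodic (haar2 R) (nilrotation R) pol.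
Proof.
pose g i := character2 (witness_x i) (witness_y i) : torus2 R -> T.
have mg i : measurable_fun setT (g i) by exact: measurable_character2.
move=> /(_ (fun i z => texp (g i z)) (fun i => Linfty_texp _ (mg i))).
have -> : \prod_(i < 4) cintegral (haar2 R) (fun z => texp (g i z)) = 0.
  (* One vanishing factor suffices: the first function is e(y), reversed by translating y by one
     half. *)
  rewrite big_ord_recl (cintegral_texp0 (mg _)
    (measure_preserving_skew_torus 0 0 (torus_pi 2^-1))) ?mul0r // => -[x y].
  by rewrite /g /character2 /skew /= !mulr0z !mulr1z !add0r addr0.
rewrite /cvg_L2 => c.
(* For N > 0 the average is a fixed function of modulus 1, so its L^2 distance to 0 is constantly
   1. *)
have c1 : (1%:E : \bar R) @[N --> \oo] --> (0 : \bar R)%E.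
  apply: cvg_trans c; apply: near_eq_cvg; near=> N.
  have N0 : (0 < N)%N by near: N; exists 1.
  rewrite -[RHS](_ : 'N[haar2 R]_2%:E[cst 1]%E = _); last first.
    rewrite Lnorm_cst1 [X in (X `^ _)%E](_ : _ = 1%E); last exact: (probability_setT (haar2 R)).
    by rewrite poweR_EFin powR1.
  apply: eq_Lnorm => z /=; congr EFin.
  rewrite (eq_bigr (fun=> texp (character2 2 1 z))) => [|n _]; last first.
    rewrite -(big_morph _ texpD texp0) /g; congr texp.
    exact: witness_resonance.
  rewrite sumr_const_nat subSS subn0 -[texp _ *+ N]mulr_natl mulrA mulVf.
    by rewrite mul1r subr0 normc_texp.
  by rewrite pnatr_eq0 -lt0n.
have [] : (0 : \bar R)%E = 1%:E.
  by apply: (cvg_unique (@ereal_hausdorff R) c1); exact: cvg_cst.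
by move=> /esym/eqP; rewrite oner_eq0.
Unshelve. all: by end_near. Qed.

End torus_exponential.

(** * Nilpotency *)

Lemma continuous_pair (U V W : topologicalType) (f : U -> V) (g : U -> W) :
  continuous f -> continuous g -> continuous (fun z => (f z, g z)).
Proof. by move=> cf cg z; exact: (cvg_pair (cf z) (cg z)). Qed.

Section nilpotency.
Variable G : groupType.
Implicit Types (S P H Z : set G).

Lemma generated_ind S P : P 1%g -> (forall x y, P x -> P y -> P (x * y)%g) ->
  (forall x, P x -> P (x^-1)%g) -> S `<=` P -> generated S `<=` P.
Proof.
move=> P1 PM PV SP x Sx.
(* [generated] quantifies over bundled boolean subgroups, so [P] has to be made boolean and bundled
   as one. *)
pose p : {pred G} := fun x => `[< P x >].
have Q1 : 1%g \in p by apply/asboolP.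
have QM : mulg_closed p.
  by move=> y z /asboolP Py /asboolP Pz; apply/asboolP; exact: PM.
have QV : invg_closed p.
  by move=> y /asboolP Py; apply/asboolP; exact: PV.
pose mM := isMulClosed.Build G p QM.
pose m1 := isMul1Closed.Build G p Q1.
pose mV := isInvClosed.Build G p QV.
pose K : groupClosed G := HB.pack p mM m1 mV.
by have /asboolP := Sx K (fun y Sy => introT (asboolP _) (SP y Sy)).
Qed.

Lemma sub_generated S : S `<=` generated S.
Proof. by move=> x Sx H; exact. Qed.

Lemma generated1 S : generated S 1%g.
Proof. by move=> H _; exact: gpred1. Qed.

(** [Z] is closed under the group operations, contains the commutators of [H] and commutes with [H],
    which bounds the step by 2; a nontrivial commutator excludes steps 0 and 1. *)
Lemma nilpotent_step2 H Z :
  Z 1%g -> (forall x y, Z x -> Z y -> Z (x * y)%g) -> (forall x, Z x -> Z (x^-1)%g) ->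
  (forall x y, H x -> H y -> Z [~ x, y]%g) ->
  (forall z y, Z z -> H y -> [~ z, y]%g = 1%g) ->
  (exists x y, [/\ H x, H y & [~ x, y]%g <> 1%g]) ->
  nilpotent_step H 2.
Proof.
move=> Z1 ZM ZV HZ ZH [x [y [Hx Hy xy]]].
have L1 : lcs H 1 `<=` Z.
  by apply: generated_ind => // _ [a Ha [b Hb ->]]; exact: HZ.
split=> [|[|[|//]] _ /= e].
- apply/seteqP; split => [|_ ->]; last exact: generated1.
  apply: generated_ind => //= [_ _ -> ->|_ ->|_ [z Lz [b Hb ->]]].
  + by rewrite mulg1.
  + by rewrite invg1.
  + by apply: ZH => //; exact: L1.
- by apply: xy; move: Hx; rewrite e /= => ->; rewrite comm1g.
- have : (generated [set z | exists2 x, H x & exists2 y, H y & z = [~ x, y]%g]) [~ x, y]%g.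
    by apply: sub_generated; exists x => //; exists y.
  by rewrite e.
Qed.

End nilpotency.

Section nilrotation_group.
Variable R : realType.
Local Notation T := (torus R).
Local Notation GT := (bijection (torus2 R)).

Lemma bskewV (a b : T) (k : int) :
  ((bskew a k b)^-1)%g = bskew (- a) (- k) (a *~ k - b).
Proof. by apply: bijectionP. Qed.

Lemma bskew_comm (a b a' b' : T) (k k' : int) :
  [~ bskew a k b, bskew a' k' b']%g = bskew 0 0 (a' *~ k - a *~ k').
Proof.
rewrite commgEl conjgE !bskewV !bskewM.
have [{}a ->] := torus_pi_surj a; have [{}b ->] := torus_pi_surj b.
have [{}a' ->] := torus_pi_surj a'; have [{}b' ->] := torus_pi_surj b'.
congr (bskew _ _ _); [|ring|].
  by rewrite -torus_pi0; torus_ring.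
torus_ring.
Qed.

Lemma nilpotent_nilrotations :
  nilpotent_step (generated (range (nilrotation R))) 2.
Proof.
have HS : generated (range (nilrotation R)) `<=`
    [set x | exists a k b, x = bskew a k b].
  apply: generated_ind => /=.
  - by exists 0, 0, 0; rewrite bskew1.
  - move=> _ _ [a [k [b ->]]] [a' [k' [b' ->]]]; rewrite bskewM.
    by do 3 eexists.
  - by move=> _ [a [k [b ->]]]; rewrite bskewV; do 3 eexists.
  - by move=> _ [i _ <-]; do 3 eexists.
apply: (nilpotent_step2 (Z := [set x | exists b : T, x = bskew 0 0 b])) => /=.
- by exists 0; rewrite bskew1.
- by move=> _ _ [b ->] [b' ->]; rewrite bskewM !addr0; eexists.
- by move=> _ [b ->]; rewrite bskewV oppr0; eexists.
- move=> x y /HS[a [k [b ->]]] /HS[a' [k' [b' ->]]]; rewrite bskew_comm.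
  by eexists.
- move=> _ y [b ->] /HS[a' [k' [b' ->]]]; rewrite bskew_comm.
  by rewrite mulr0z mul0rz subrr bskew1.
- exists (nilrotation R 0), (nilrotation R 1); split.
  + by apply: sub_generated; exists 0.
  + by apply: sub_generated; exists 1.
  (* The commutator is the vertical translation by 2 sqrt 2 - 4 sqrt 3, seen at the origin; it is
     nontrivial because this number is not an integer. *)
  rewrite bskew_comm => /(congr1 (fun f : GT => (f 0).2)).
  rewrite /= /skew /= mul0rz add0r add0r -!torus_piMz -torus_piB.
  move=> /torus_pi_eq0 /intrP[m e].
  have [] := @sqrt23_indep R 2 (-4) m.
    by rewrite -e /rotation /=; ring.
  by [].
Qed.

Lemma torus_mulz_continuous (k : int) : continuous (fun z : T => z *~ k).
Proof.
apply/quotient_continuous.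
rewrite (_ : _ \o _ = (\pi_(torus R) : R -> T) \o (fun x => k%:~R * x)); last first.
  by apply/funext => x /=; exact/esym/torus_piMz.
move=> x; apply: continuous_comp; last exact: torus_pi_continuous.
exact: mulrl_continuous.
Qed.

Lemma skew_continuous (a b : T) (k : int) : continuous (skew a k b).
Proof.
have cD (f g : torus2 R -> T) : continuous f -> continuous g ->
    continuous (fun z => f z + g z).
  move=> cf cg z.
  apply: (continuous_comp (f := fun z => (f z, g z)) (g := fun w : T * T => w.1 + w.2)).
    exact: continuous_pair.
  exact: torus_add_continuous.
have cc (c : T) : continuous (fun _ : torus2 R => c) by move=> z; exact: cvg_cst.
have c1 : continuous (fun z : torus2 R => z.1) by move=> z; exact: cvg_fst.
have c2 : continuous (fun z : torus2 R => z.2) by move=> z; exact: cvg_snd.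
apply: continuous_pair; first exact: (cD _ _ c1 (cc a)).
apply: (cD (fun z => z.2 + z.1 *~ k) (fun=> b) _ (cc b)).
apply: (cD _ (fun z => z.1 *~ k) c2) => z.
by apply: (continuous_comp (g := fun x : T => x *~ k)); [exact: c1|exact: torus_mulz_continuous].
Qed.

Definition shear (k : int) : torus2 R -> torus2 R := skew 0 k 0.

Lemma shear_additive k : additive (shear k).
Proof.
move=> [x y] [x' y']; rewrite /shear /skew /=; congr (_, _); rewrite /= !addr0 //.
by rewrite mulrzBl opprD addrACA.
Qed.

HB.instance Definition _ k :=
  GRing.isZmodMorphism.Build (torus2 R) (torus2 R) (shear k) (shear_additive k).

Lemma unipotent_nilrotation i : unipotent_affine (nilrotation R i).
Proof.
exists (shear 2), (torus_pi (rotation R i), torus_pi (rotation R i) + torus_pi (drift R i)).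
split.
- split; first exact: skew_continuous.
  exists (skew (- 0) (- 2) (0 *~ 2 - 0)).
  by split; [exact: skewK|exact: skewVK|exact: skew_continuous].
(* The shear minus the identity takes values in the vertical axis and vanishes there. *)
- exists 2%N => -[x y]; rewrite /= /shear /skew /=.
  by congr (_, _); rewrite /= ?addr0 ?subrr ?mul0rz ?addr0 ?subrr.
- by move=> [x y]; rewrite /= /shear /skew /=; congr (_, _); rewrite /= !addr0.
Qed.

End nilrotation_group.

(** * The acting Lie group *)

(** The part of the Heisenberg group with integral shear coordinate. A real shear coordinate would
    give a three-dimensional quotient; a discrete one is absorbed entirely by the lattice and leaves
    the torus. *)
Definition skew_group (R : realType) : Type := (discrete_topology int * (R * R))%type.

Section skew_group.
Variable R : realType.
Local Notation G := (skew_group R).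

HB.instance Definition _ :=
  Topological.copy (skew_group R) (discrete_topology int * (R * R))%type.

Definition sg (k : int) (a b : R) : G := (k, (a, b)).
Definition sg_k (g : G) : int := g.1.
Definition sg_a (g : G) : R := g.2.1.
Definition sg_b (g : G) : R := g.2.2.

(* [sg k a b] acts on the torus by the map [skew a k b]. *)
Definition sg_mul (g h : G) : G :=
  sg (sg_k g + sg_k h) (sg_a g + sg_a h) (sg_b g + sg_b h + (sg_k g)%:~R * sg_a h).
Definition sg_inv (g : G) : G :=
  sg (- sg_k g) (- sg_a g) ((sg_k g)%:~R * sg_a g - sg_b g).

Lemma sgE (g : G) : g = sg (sg_k g) (sg_a g) (sg_b g).
Proof. by case: g => k [a b]. Qed.

Lemma sg_eq k a b k' a' b' : k = k' -> a = a' -> b = b' -> sg k a b = sg k' a' b'.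
Proof. by move=> -> -> ->. Qed.

Fact sg_mulA : associative sg_mul.
Proof.
move=> [k [a b]] [l [c e]] [m [f h]]; apply: sg_eq;
  by rewrite /sg_mul /sg_k /sg_a /sg_b /= ?intrD; ring.
Qed.
Fact sg_1mul : left_id (sg 0 0 0) sg_mul.
Proof. by move=> [k [a b]]; apply: sg_eq; rewrite /sg_mul /sg_inv /sg_k /sg_a /sg_b /=; ring. Qed.
Fact sg_mul1 : right_id (sg 0 0 0) sg_mul.
Proof. by move=> [k [a b]]; apply: sg_eq; rewrite /sg_mul /sg_inv /sg_k /sg_a /sg_b /=; ring. Qed.
Fact sg_Vmul : left_inverse (sg 0 0 0) sg_inv sg_mul.
Proof.
move=> [k [a b]]; apply: sg_eq;
  by rewrite /sg_mul /sg_inv /sg_k /sg_a /sg_b /= ?mulrNz; ring.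
Qed.
Fact sg_mulV : right_inverse (sg 0 0 0) sg_inv sg_mul.
Proof.
move=> [k [a b]]; apply: sg_eq;
  by rewrite /sg_mul /sg_inv /sg_k /sg_a /sg_b /= ?mulrNz; ring.
Qed.

HB.instance Definition _ :=
  isGroup.Build (skew_group R) sg_mulA sg_1mul sg_mul1 sg_Vmul sg_mulV.

Lemma continuous_sg (U : topologicalType) (k : U -> discrete_topology int) (a b : U -> R) :
  continuous k -> continuous a -> continuous b ->
  continuous (fun u => sg (k u) (a u) (b u) : G).
Proof. by move=> ck ca cb; do 2 apply: continuous_pair => //. Qed.

Lemma continuous_discrete (U : topologicalType) (D : discreteTopologicalType) (f : D -> U) :
  continuous f.
Proof.
move=> x A /nbhs_singleton Ax.
by apply: filterS (discrete_set1 x) => y ->.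
Qed.

Lemma continuous_sg_k : continuous (sg_k : G -> discrete_topology int).
Proof. by move=> g; exact: cvg_fst. Qed.
Lemma continuous_sg_a : continuous (sg_a : G -> R).
Proof.
by move=> g; apply: (continuous_comp (f := snd) (g := fst)); [exact: cvg_snd|exact: cvg_fst].
Qed.
Lemma continuous_sg_b : continuous (sg_b : G -> R).
Proof.
by move=> g; apply: (continuous_comp (f := snd) (g := snd)); [exact: cvg_snd|exact: cvg_snd].
Qed.

Lemma continuous_discreteM (U : topologicalType) (D : discreteTopologicalType)
    (V : topologicalType) (f : D -> D -> V) (k l : U -> D) :
  continuous k -> continuous l -> continuous (fun u => f (k u) (l u)).
Proof.
move=> ck cl u A /nbhs_singleton Af.
have nk : \forall v \near u, k v = k u := ck u _ (discrete_set1 (k u)).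
have nl : \forall v \near u, l v = l u := cl u _ (discrete_set1 (l u)).
suff : \forall v \near u, A (f (k v) (l v)) by [].
by apply: filterS2 nk nl => v -> ->.
Qed.

Fact sg_mul_continuous : continuous (fun xy : G * G => (xy.1 * xy.2)%g).
Proof.
have c1 : continuous (fun z : G * G => z.1) by move=> z; exact: cvg_fst.
have c2 : continuous (fun z : G * G => z.2) by move=> z; exact: cvg_snd.
have co (V W : topologicalType) (f : V -> W) (h : G * G -> V) :
    continuous h -> continuous f -> continuous (fun z => f (h z)).
  by move=> ch cf z; apply: (continuous_comp (f := h) (g := f)); [exact: ch|exact: cf].
have k1 := co _ _ _ _ c1 continuous_sg_k; have k2 := co _ _ _ _ c2 continuous_sg_k.
have a1 := co _ _ _ _ c1 continuous_sg_a; have a2 := co _ _ _ _ c2 continuous_sg_a.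
have b1 := co _ _ _ _ c1 continuous_sg_b; have b2 := co _ _ _ _ c2 continuous_sg_b.
have k1R : continuous (fun z : G * G => (sg_k z.1)%:~R : R).
  exact: (co _ _ (fun k : discrete_topology int => (k : int)%:~R : R) _ k1
     (@continuous_discrete _ _ _)).
apply: continuous_sg.
- exact: (@continuous_discreteM _ _ _
    (fun k l : discrete_topology int => (k : int) + (l : int) : discrete_topology int)
    _ _ k1 k2).
- by move=> z; apply: cvgD; [exact: a1|exact: a2].
- move=> z; apply: cvgD; first by apply: cvgD; [exact: b1|exact: b2].
  by apply: cvgM; [exact: k1R|exact: a2].
Qed.

Fact sg_inv_continuous : continuous (fun x : G => (x^-1)%g).
Proof.
have kR : continuous (fun z : G => (sg_k z)%:~R : R).
  move=> z; apply: (continuous_comp (f := sg_k : G -> discrete_topology int)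
    (g := fun k : discrete_topology int => (k : int)%:~R : R)).
    exact: continuous_sg_k.
  exact: continuous_discrete.
apply: continuous_sg.
- exact: (@continuous_discreteM _ _ _
    (fun k l : discrete_topology int => - (k : int) : discrete_topology int)
    _ _ continuous_sg_k continuous_sg_k).
- by move=> z; apply: cvgN; exact: continuous_sg_a.
- move=> z; apply: cvgB; last exact: continuous_sg_b.
  by apply: cvgM; [exact: kR|exact: continuous_sg_a].
Qed.

HB.instance Definition _ :=
  isTopologicalGroup.Build (skew_group R) sg_mul_continuous sg_inv_continuous.


End skew_group.
Arguments sg_k {R} g.
Arguments sg_a {R} g.
Arguments sg_b {R} g.
Arguments continuous_sg_k {R}.
Arguments continuous_sg_a {R}.
Arguments continuous_sg_b {R}.

(** * Smoothness of affine maps *)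

Section affine_smooth.
Variable R : realType.

Definition affine_map n m (f : 'rV[R]_n -> 'rV[R]_m) :=
  forall t u v, f (t *: u + v) = t *: (f u - f 0) + f v.

Lemma affine_mapE n m (f : 'rV[R]_n -> 'rV[R]_m) : affine_map f ->
  forall u, f u = \sum_j u 0 j *: (f (delta_mx 0 j) - f 0) + f 0.
Proof.
move=> af u.
have H (s : seq 'I_n) : f (\sum_(j <- s) u 0 j *: delta_mx 0 j) =
    \sum_(j <- s) u 0 j *: (f (delta_mx 0 j) - f 0) + f 0.
  elim: s => [|j s IH]; first by rewrite !big_nil add0r.
  by rewrite !big_cons af IH addrA.
by rewrite -H -row_sum_delta.
Qed.

Lemma affine_differentiable n m (f : 'rV[R]_n -> 'rV[R]_m) x : affine_map f ->
  differentiable f x.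
Proof.
move=> af.
rewrite (_ : f = (\sum_j (fun u : 'rV[R]_n => u 0 j *: (f (delta_mx 0 j) - f 0))) + cst (f 0)).
  apply: differentiableD => //; apply: differentiable_sum => j.
  apply: differentiableZl; exact: differentiable_coord.
by apply/funext => u; rewrite [LHS](affine_mapE af) /= fctE fct_sumE.
Qed.

Lemma affine_derive n m (f : 'rV[R]_n -> 'rV[R]_m) v x : affine_map f ->
  'D_v f x = f v - f 0.
Proof.
move=> af; rewrite /derive; apply: cvg_lim; first exact: norm_hausdorff.
apply: cvg_near_cst; near=> h.
have h0 : h != 0 by near: h; exact: nbhs_dnbhs_neq.
by rewrite /= af addrK scalerA mulVf // scale1r.
Unshelve. all: by end_near. Qed.

(** A directional derivative of an affine map is constant, hence affine again, so induction on the
    order of differentiability closes up. *)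
Lemma smooth_affine n m (U : set 'rV[R]_n) (f : 'rV[R]_n -> 'rV[R]_m) :
  affine_map f -> smooth U f.
Proof.
move=> af k; elim: k f af => [|k IH] f af /=.
  by move=> x _; apply: differentiable_continuous; exact: affine_differentiable.
split=> [x _|v]; first exact: affine_differentiable.
apply: IH => t u w; rewrite !affine_derive // subrr scaler0 add0r //.
Qed.

End affine_smooth.

Section skew_group_lie.
Variable R : realType.
Local Notation G := (skew_group R).

Definition sg_coord (g : G) : 'rV[R]_2 := \row_(i < 2) (if i == 0 then sg_a g else sg_b g).

Definition sg_uncoord (k : int) (u : 'rV[R]_2) : G := sg k (u 0 0) (u 0 1).

(** One chart for each value of the discrete coordinate; each is onto the whole plane. *)
Definition sg_chart (k : int) : chart R G 2 :=
  Chart [set g | sg_k g = k] sg_coord (sg_uncoord k).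

Definition sg_atlas : set (chart R G 2) := range sg_chart.

Lemma sg_coordK k g : sg_k g = k -> sg_uncoord k (sg_coord g) = g.
Proof. by move=> <-; rewrite [RHS]sgE /sg_uncoord !mxE. Qed.

Lemma sg_uncoordK k u : sg_coord (sg_uncoord k u) = u.
Proof.
apply/rowP => i; rewrite mxE /sg_uncoord.
by case: i => [[|[|//]]] h /=; congr (u _ _); apply: val_inj.
Qed.

Lemma sg_coord_continuous : continuous sg_coord.
Proof.
have -> : sg_coord = fun g => sg_a g *: delta_mx 0 0 + sg_b g *: delta_mx 0 1.
  apply/funext => g; apply/rowP => i; rewrite !mxE.
  by case: i => [[|[|//]]] h /=; rewrite ?mulr1 ?mulr0 ?addr0 ?add0r.
move=> g; apply: cvgD; apply: cvgZr_tmp; [exact: continuous_sg_a|exact: continuous_sg_b].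
Qed.

Lemma sg_uncoord_continuous k : continuous (sg_uncoord k).
Proof.
apply: (continuous_sg (k := fun=> k) (a := fun u : 'rV[R]_2 => u 0 0)
  (b := fun u : 'rV[R]_2 => u 0 1)).
- exact: cst_continuous.
- exact: coord_continuous.
- exact: coord_continuous.
Qed.

Lemma sg_is_chart k : is_chart (sg_chart k).
Proof.
split.
- rewrite (_ : chart_dom _ = (sg_k : G -> discrete_topology int) @^-1` [set k]) //.
  by apply: open_comp; [move=> g _; exact: continuous_sg_k|exact: discrete_open].
- rewrite (_ : chart_codom _ = setT); first exact: openT.
  apply/seteqP; split => // u _; exists (sg_uncoord k u) => //=.
  exact: sg_uncoordK.
- by move=> g; rewrite inE => /sg_coordK.
- by apply: continuous_subspaceT; exact: sg_coord_continuous.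
- by apply: continuous_subspaceT; exact: sg_uncoord_continuous.
Qed.

Lemma sg_smooth_atlas : smooth_atlas sg_atlas.
Proof.
split.
- by move=> _ [k _ <-]; exact: sg_is_chart.
- by move=> g; exists (sg_chart (sg_k g)) => //; exists (sg_k g).
- move=> _ _ [k _ <-] [l _ <-]; apply: smooth_affine => t u v /=.
  by rewrite !sg_uncoordK subr0.
Qed.

(** On fixed components the multiplication is affine in the coordinates: in its only product, [k]
    times the first coordinate of the right factor, [k] is constant. *)
Lemma sg_smooth_mul : smooth_mul sg_atlas.
Proof.
move=> _ _ _ [k _ <-] [l _ <-] [m _ <-]; apply: smooth_affine => t u v /=.
apply/rowP => i; rewrite !mxE /=.
by case: ifP => _; rewrite /sg_a /sg_b /= /sg_a /sg_b /= !mxE; ring.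
Qed.

Lemma sg_smooth_inv : smooth_inv sg_atlas.
Proof.
move=> _ _ [k _ <-] [l _ <-]; apply: smooth_affine => t u v /=.
apply/rowP => i; rewrite !mxE /=.
by case: ifP => _; rewrite /sg_a /sg_b /= /sg_k /sg_a /sg_b /= ?mxE /=; ring.
Qed.

Lemma cluster_continuous (U V : topologicalType) (f : U -> V) p q :
  continuous f -> cluster (nbhs p) q -> cluster (nbhs (f p)) (f q).
Proof.
move=> cf pq A B nA nB.
have [x [Ax Bx]] := pq _ _ (cf p _ nA) (cf q _ nB).
by exists (f x).
Qed.

Lemma sg_hausdorff : hausdorff_space G.
Proof.
move=> p q pq; rewrite (sgE p) (sgE q).
have hk := discrete_hausdorff (cluster_continuous continuous_sg_k pq).
have ha := @Rhausdorff R _ _ (cluster_continuous continuous_sg_a pq).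
have hb := @Rhausdorff R _ _ (cluster_continuous continuous_sg_b pq).
exact: sg_eq.
Qed.

Lemma rat_itv_nbhs (a : R) (V : set R) : nbhs a V -> exists p q : rat,
  ratr p < a < ratr q /\ forall x, ratr p < x < ratr q -> V x.
Proof.
move=> /nbhs_ballP[e /= e0 eV].
have [|p] := @rat_in_itvoo R (a - e) a; first by rewrite ltrBlDr ltrDl.
rewrite in_itv /= => /andP[p1 p2].
have [|q] := @rat_in_itvoo R a (a + e); first by rewrite ltrDl.
rewrite in_itv /= => /andP[q1 q2].
exists p, q; split; first by rewrite p2 q1.
move=> x /andP[x1 x2]; apply: eV; rewrite /ball /= ltr_norml; lra.
Qed.

Lemma sg_second_countable : @second_countable G.
Proof.
pose box (z : int * (rat * rat) * (rat * rat)) : set G :=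
  [set g | [/\ sg_k g = z.1.1, ratr z.1.2.1 < sg_a g < ratr z.1.2.2 &
     ratr z.2.1 < sg_b g < ratr z.2.2]].
have obox z : open (box z).
  have -> : box z = (sg_k : G -> discrete_topology int) @^-1` [set z.1.1] `&`
      (sg_a @^-1` `]ratr z.1.2.1, ratr z.1.2.2[%classic `&`
       sg_b @^-1` `]ratr z.2.1, ratr z.2.2[%classic).
    by apply/seteqP; split => g /=; rewrite !in_itv /=;
      [move=> [? ? ?]; split; last split|move=> [? [? ?]]; split].
  apply: openI.
    by apply: open_comp; [move=> g _; exact: continuous_sg_k|exact: discrete_open].
  apply: openI; apply: open_comp (interval_open _ _) => // g _.
    exact: continuous_sg_a.
  exact: continuous_sg_b.
exists (range box); first by apply: sub_countable (card_image_le _ _) _; exact: countableP.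
split; first by move=> _ [z _ <-].
move=> [k [a b]] A [[U W] /= [nU [[V1 V2] /= [nV1 nV2] VW]] UA].
have [p1 [q1 [h1 H1]]] := rat_itv_nbhs nV1.
have [p2 [q2 [h2 H2]]] := rat_itv_nbhs nV2.
exists (box (k, (p1, q1), (p2, q2))).
  by split; [exists (k, (p1, q1), (p2, q2))|split].
move=> [l [x y]] [/= lk hx hy]; apply: UA; split => /=.
  by move: lk; rewrite /sg_k /= => ->; exact: nbhs_singleton.
by apply: VW; split; [exact: H1|exact: H2].
Qed.

Lemma sg_is_lie_group : is_lie_group R (skew_group R).
Proof.
split; [exact: sg_hausdorff|exact: sg_second_countable|].
exists 2%N, sg_atlas; split.
- exact: sg_smooth_atlas.
- exact: sg_smooth_mul.
- exact: sg_smooth_inv.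
Qed.

End skew_group_lie.

(** * The nilsystem *)

Section skew_nilsystem.
Variable R : realType.
Local Notation G := (skew_group R).
Local Notation T := (torus R).
Local Notation tpi := (@torus_pi R).

Definition sg_lattice : {pred G} :=
  fun g => (sg_a g \is a Num.int) && (sg_b g \is a Num.int).

Fact sg_lattice1 : 1%g \in sg_lattice.
Proof. by apply/andP; split; exact: rpred0. Qed.

Fact sg_latticeM : mulg_closed sg_lattice.
Proof.
move=> g h /andP[ga gb] /andP[ha hb]; apply/andP; split; first exact: rpredD.
by rewrite /sg_b /= !rpredD // rpredM // intr_int.
Qed.

Fact sg_latticeV : invg_closed sg_lattice.
Proof.
move=> g /andP[ga gb]; apply/andP; split; first by rewrite /sg_a /= rpredN.
by rewrite /sg_b /= rpredB // rpredM // intr_int.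
Qed.

HB.instance Definition _ := isMulClosed.Build (skew_group R) sg_lattice sg_latticeM.
HB.instance Definition _ := isMul1Closed.Build (skew_group R) sg_lattice sg_lattice1.
HB.instance Definition _ := isInvClosed.Build (skew_group R) sg_lattice sg_latticeV.

Local Notation Gamma := (sg_lattice : groupClosed G).
Local Notation Q := (coset_space Gamma).
Local Notation qpi := (\pi_(Q) : G -> Q).

(** The twist in the second coordinate of [g^-1 * h] is an integer multiple of the difference of the
    first coordinates, so it is integral once that difference is; the discrete coordinate puts no
    condition at all. *)
Lemma coset_piP (g h : G) : qpi g = qpi h <->
  tpi (sg_a g) = tpi (sg_a h) /\ tpi (sg_b g) = tpi (sg_b h).
Proof.
have E : (g^-1 * h)%g \in sg_lattice <->
    sg_a h - sg_a g \is a Num.int /\ sg_b h - sg_b g \is a Num.int.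
  have ea : sg_a (g^-1 * h)%g = sg_a h - sg_a g by rewrite addrC.
  have eb : sg_b (g^-1 * h)%g = (sg_b h - sg_b g) - (sg_k g)%:~R * (sg_a h - sg_a g).
    by rewrite /sg_b /= /sg_b /sg_a /sg_k /= mulrNz; ring.
  rewrite unfold_in /sg_lattice ea eb; split=> [/andP[h1 h2]|[h1 h2]].
    split=> //; rewrite -(subrK ((sg_k g)%:~R * (sg_a h - sg_a g)) (sg_b h - sg_b g)).
    by rewrite rpredD // rpredM // intr_int.
  by rewrite h1 rpredB // rpredM // intr_int.
have P : qpi g = qpi h <-> (g^-1 * h)%g \in sg_lattice.
  exact: (rwP (@eqmodP G (coset_equiv Gamma) g h)).
rewrite P E -torus_pi_eq -torus_pi_eq.
by split=> -[-> ->].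
Qed.

Lemma coset_repr (q : Q) : qpi (repr q) = q.
Proof. exact: reprK. Qed.

Definition sg_phi (q : Q) : torus2 R := (tpi (sg_a (repr q)), tpi (sg_b (repr q))).

Lemma sg_phi_pi g : sg_phi (qpi g) = (tpi (sg_a g), tpi (sg_b g)).
Proof. by have /coset_piP[h1 h2] := coset_repr (qpi g); rewrite /sg_phi h1 h2. Qed.

Definition sg_psi (z : torus2 R) : Q := qpi (sg 0 (torus_section z.1) (torus_section z.2)).

Lemma sg_phiK : cancel sg_phi sg_psi.
Proof.
move=> q; rewrite -[q]coset_repr sg_phi_pi; apply/coset_piP.
by split; rewrite /= torus_sectionK.
Qed.

Lemma sg_psiK : cancel sg_psi sg_phi.
Proof. by move=> [x y]; rewrite /sg_psi sg_phi_pi /= !torus_sectionK. Qed.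

Lemma sg_phi_continuous : continuous sg_phi.
Proof.
apply/quotient_continuous.
rewrite (_ : _ \o _ = fun g => (\pi_(torus R) (sg_a g) : T, \pi_(torus R) (sg_b g) : T)).
  apply: continuous_pair => g.
    by apply: (continuous_comp (f := @sg_a R)); [exact: continuous_sg_a|exact: torus_pi_continuous].
  by apply: (continuous_comp (f := @sg_b R)); [exact: continuous_sg_b|exact: torus_pi_continuous].
by apply/funext => g; exact: sg_phi_pi.
Qed.

Definition sg_fiber (u : R * R) : Q := qpi (sg 0 u.1 u.2).

Lemma sg_fiber_continuous : continuous sg_fiber.
Proof.
have c : continuous (fun u : R * R => sg 0 u.1 u.2 : G).
  apply: (continuous_sg (k := fun=> 0) (a := fst) (b := snd)).
  - exact: cst_continuous.
  - by move=> u; exact: cvg_fst.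
  - by move=> u; exact: cvg_snd.
move=> u; apply: (continuous_comp (f := fun u : R * R => sg 0 u.1 u.2 : G)); first exact: c.
exact: pi_continuous.
Qed.

Lemma sg_psi_torus_pi (a b : R) : sg_psi (tpi a, tpi b) = sg_fiber (a, b).
Proof. by apply/coset_piP; split; rewrite /= torus_sectionK. Qed.

(** [torus_section] jumps at 0, so continuity is obtained by lifting the point to any real pair,
    using the continuous map [sg_fiber] there, and pushing a box down through the open
    projections. *)
Lemma sg_psi_continuous : continuous sg_psi.
Proof.
move=> [x y] A; have [a ->] := torus_pi_surj x; have [b ->] := torus_pi_surj y.
rewrite sg_psi_torus_pi => /sg_fiber_continuous[[U V] /= [nU nV] UV].
move: nU nV; rewrite nbhsE => -[U' [oU' U'a] U'U].
rewrite nbhsE => -[V' [oV' V'b] V'V].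
exists ((\pi_(torus R) : R -> T) @` U', (\pi_(torus R) : R -> T) @` V').
  by split => /=; apply: open_nbhs_nbhs; (split; first exact: torus_pi_open);
    [exists a|exists b].
move=> [_ _] /= [[u Uu <-] [v Vv <-]].
have := UV (u, v) (conj (U'U _ Uu) (V'V _ Vv)) => /=.
by rewrite -sg_psi_torus_pi.
Qed.

Lemma sg_lattice_discrete : discrete_subgroup Gamma.
Proof.
move=> x xG.
exists ((sg_k : G -> discrete_topology int) @^-1` [set sg_k x] `&`
  (sg_a @^-1` ball (sg_a x) 1 `&` sg_b @^-1` ball (sg_b x) 1)).
  apply: openI.
    by apply: open_comp; [move=> g _; exact: continuous_sg_k|exact: discrete_open].
  by apply: openI; (apply: open_comp; last exact: ball_open) => g _;
    [exact: continuous_sg_a|exact: continuous_sg_b].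
have near_int (a b : R) : a \is a Num.int -> b \is a Num.int -> ball a 1 b -> b = a.
  move=> /intrP[m ->] /intrP[n ->]; rewrite /ball /= -intrB -intr_norm.
  rewrite -[1]/(1%:~R) ltr_int => h; congr (_%:~R); lia.
move: xG => /andP[xa xb].
apply/seteqP; split=> [y [[ky [ay by_]] /andP[ya yb]]|_ ->] /=.
  rewrite (sgE y) (sgE x); apply: sg_eq; [exact: ky|exact: near_int|exact: near_int].
by split; [split=> //; split; exact: ballxx|exact/andP].
Qed.

Lemma sg_coset_compact : compact [set: Q].
Proof.
have -> : [set: Q] = sg_fiber @` (`[0, 1]%classic `*` `[0, 1]%classic).
  apply/seteqP; split=> // q _.
  rewrite -(sg_phiK q); case: (sg_phi q) => x y.
  exists (torus_section x, torus_section y); last first.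
    by rewrite -sg_psi_torus_pi !torus_sectionK.
  split=> /=; rewrite in_itv /=.
    by have /andP[-> /ltW ->] := torus_section_itv x.
  by have /andP[-> /ltW ->] := torus_section_itv y.
apply: continuous_compact.
  by apply: continuous_subspaceT; exact: sg_fiber_continuous.
by apply: compact_setX; exact: segment_compact.
Qed.

Lemma sg_phi_translate (g : G) (q : Q) :
  sg_phi (coset_translate g q) = skew (tpi (sg_a g)) (sg_k g) (tpi (sg_b g)) (sg_phi q).
Proof.
rewrite /coset_translate sg_phi_pi /sg_phi /skew /=.
congr (_, _); first by rewrite -torus_piD addrC.
rewrite -torus_piMz -!torus_piD; congr (tpi _).
by rewrite /sg_b /=; ring.
Qed.

Lemma sg_comm (g h : G) :
  [~ g, h]%g = sg 0 0 ((sg_k g)%:~R * sg_a h - (sg_k h)%:~R * sg_a g).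
Proof.
rewrite commgEl conjgE -[LHS]/(sg_mul (sg_inv g) (sg_mul (sg_inv h) (sg_mul g h))).
case: g h => k [a b] [l [c e]].
by apply: sg_eq; rewrite /sg_mul /sg_inv /sg_a /sg_b /sg_k /= ?(mulrNz, intrD); ring.
Qed.

Lemma sg_nilpotent : nilpotent_step [set: G] 2.
Proof.
apply: (nilpotent_step2 (Z := [set g | exists b, g = sg 0 0 b])) => /=.
- by exists 0.
- by move=> _ _ [b ->] [c ->]; exists (b + c); apply: sg_eq; rewrite /sg_k /sg_a /sg_b /=; ring.
- by move=> _ [b ->]; exists (- b); apply: sg_eq; rewrite /sg_k /sg_a /sg_b /=; ring.
- by move=> g h _ _; rewrite sg_comm; eexists.
- move=> _ h [b ->] _; rewrite sg_comm; apply: sg_eq; rewrite /sg_k /sg_a //=; ring.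
- exists (sg 1 0 0), (sg 0 1 0); split => //; rewrite sg_comm => /(congr1 (@sg_b R)).
  by rewrite /sg_b /sg_k /sg_a /= mulr1 mul0r subr0 => /eqP; rewrite oner_eq0.
Qed.

Lemma nilsystem_nilrotation : nilsystem 2 (nilrotation R).
Proof.
exists (skew_group R), Gamma, sg_phi; split; split.
- exact: sg_is_lie_group.
- exact: sg_nilpotent.
- exact: sg_lattice_discrete.
- exact: sg_coset_compact.
- split; first exact: sg_phi_continuous.
  by exists sg_psi; split; [exact: sg_phiK|exact: sg_psiK|exact: sg_psi_continuous].
- move=> g A mA.
  (* The image of a set under the translation by [g] is its preimage under the inverse skew map,
     which preserves Haar measure. *)
  have mp := measure_preserving_skew_torus (- tpi (sg_a g)) (- sg_k g)
    (tpi (sg_a g) *~ (sg_k g) - tpi (sg_b g)).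
  rewrite -(mp.2 _ mA); congr (haar2 R _); apply/seteqP; split=> z /=.
    by move=> [q Aq <-]; rewrite sg_phi_translate skewK.
  move=> Az; exists (sg_psi (skew (- tpi (sg_a g)) (- sg_k g)
    (tpi (sg_a g) *~ (sg_k g) - tpi (sg_b g)) z)); first by rewrite /= sg_psiK.
  by rewrite sg_phi_translate sg_psiK skewVK.
- move=> i; exists (sg 2 (rotation R i) (rotation R i + drift R i)) => q.
  by rewrite sg_phi_translate /= torus_piD.
Qed.

Lemma affine_nilsystem_nilrotation : affine_nilsystem 2 (nilrotation R).
Proof.
split; [exact: unipotent_nilrotation|exact: nilsystem_nilrotation|].
exact: nilpotent_nilrotations.
Qed.

End skew_nilsystem.

Theorem theorem1p14 (R : realType) :
  exists (T : 'I_4 -> bijection (torus2 R)) (p : 'I_4 -> {poly int}),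
    [/\ affine_nilsystem 2 T,
        ergodic (haar2 R \x haar2 R \x haar2 R \x haar2 R)%E
          (fun n => prod4 (fun i => zpow (T i) (p i).[n])),
        forall i j : 'I_4, (i < j)%N ->
          ergodic (haar2 R)
            (fun n => (zpow (T i) (p i).[n] * zpow (T j) (- (p j).[n]))%g)
      & ~ jointly_ergodic (haar2 R) T p].
Proof.
exists (nilrotation R), pol; split.
- exact: affine_nilsystem_nilrotation.
- exact: ergodic_product.
- exact: ergodic_difference.
- exact: not_jointly_ergodic.
Qed.
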